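(* Let $k$ be a field, let $Q\subseteq\mathbb{Z}^d$ be a normal affine semigroup that generates $\mathbb{Z}^d$ as a group and has trivial unit group, and let $\Delta$ be a closed polyhedral subcomplex of the cone $\mathbb{R}_{\geq0}Q$. The total complex $\mathrm{tot}\,D(\Delta)$ of the Zeeman double complex $D(\Delta)$ is an irreducible resolution of $k[Q]/I_\Delta$.
   Context: All modules are $\mathbb{Z}^d$-graded, with degree-preserving homomorphisms; graded ideals of $k[Q]$ are monomial ideals. $\mathbf{x}^a$ denotes the monomial with exponent $a$. Faces. A face of $Q$ is a subset $F=\{a\in Q\mid \ell(a)=0\}$ for a linear functional $\ell$ on $\mathbb{Z}^d$ that is nonnegative on $Q$ (so $Q$ and $\{\mathbf 0\}$ are faces). Faces of $Q$ are identified with the faces of the polyhedral cone $\mathbb{R}_{\ge0}Q$; $\dim F$ is the dimension of the real span of $F$; a facet of a face $G$ is a face $G'\subset G$ with $\dim G'=\dim G-1$. A closed polyhedral subcomplex $\Delta$ is a set of faces closed under passing to subfaces. $I_\Delta$ is the ideal of $k[Q]$ spanned over $k$ by all monomials of $k[Q]$ whose exponents do not lie on any face of $\Delta$. For a face $G$, $k[G]$ is regarded as the quotient of $k[Q]$ by the ideal spanned by $\mathbf{x}^a$, $a\in Q\smallsetminus G$, with generator $e_G$ in degree $\mathbf 0$. Incidence function. Fix signs $\varepsilon(G',G)\in\{\pm1\}$ for each facet $G'$ of each face $G$ such that whenever $G''\subset G$ has codimension $2$ and $G_1,G_2$ are the two faces strictly between, $\varepsilon(G'',G_1)\varepsilon(G_1,G)+\varepsilon(G'',G_2)\varepsilon(G_2,G)=0$.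 Zeeman double complex. $D(\Delta)=\bigoplus_{F\supseteq G;\ F,G\in\Delta}kF\otimes_k k[G]$, where $kF$ is a one-dimensional $k$-vector space with basis $F$ in $\mathbb{Z}^d$-degree $\mathbf 0$; $D(\Delta)_{pq}$ is generated by the $F\otimes e_G$ with $p=\dim F$ and $-q=\dim G$. The vertical differential is $\partial(F\otimes e_G)=F\otimes\sum_{G'}\varepsilon(G',G)e_{G'}$ (sum over facets $G'$ of $G$), and the horizontal differential is $\delta(F\otimes e_G)=(-1)^q\sum_{F'}\varepsilon(F,F')F'\otimes e_G$ (sum over $F'\in\Delta$ having $F$ as a facet). The total complex has $\bigoplus_{p+q=i}D(\Delta)_{pq}$ in cohomological degree $i$ and differential $\delta+\partial$. Irreducible resolutions. An ideal $W\subseteq k[Q]$ is irreducible if it cannot be expressed as an intersection of two ideals properly containing it. An irreducible resolution of a module $M$ is an exact sequence $0\to M\to\overline{W}^0\to\overline{W}^1\to\cdots$ with $\overline{W}^i=\bigoplus_{j=1}^{\mu_i}k[Q]/W^{ij}$ and each $W^{ij}$ an irreducible ideal; a complex $\overline{W}^\bullet$ is said to be an irreducible resolution of $M$ if it can be augmented by a map $M\to\overline{W}^0$ to such an exact sequence. *)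

(* Defs.v *)
From HB Require Import structures.
From mathcomp Require Import all_boot all_order all_algebra finmap.
From mathcomp Require Import ring_quotient.
From mathcomp Require Import boolp classical_sets functions cardinality reals.
From mathcomp Require Import monalg.

Set Implicit Arguments.
Unset Strict Implicit.
Unset Printing Implicit Defensive.

Import Order.TTheory GRing.Theory Num.Theory.
Import Quotient.

Local Open Scope classical_set_scope.
Local Open Scope ring_scope.
Local Open Scope quotient_scope.

(* A finitely generated submonoid of Z^d with trivial unit group.  The
   condition on units is part of the structure because [monomType], hence the
   ring structure of [{malg k[_]}], requires it. *)
Record pointedAffineSemigroup (d : nat) := PointedAffineSemigroup {
  sgset : set 'rV[int]_d;
  sg_fg : exists (n : nat) (g : 'I_n -> 'rV[int]_d),
    sgset = [set a | exists c : 'I_n -> nat, a = \sum_i g i *+ c i];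
  sg_pointed : forall a, sgset a -> sgset (- a) -> a = 0
}.

Section Semigroup.
Context {d : nat}.
Implicit Types (Q : pointedAffineSemigroup d) (a b z : 'rV[int]_d).

Lemma sg0 Q : sgset Q 0.
Proof.
have [n [g ->]] := sg_fg Q; exists (fun=> 0%N).
by rewrite big1 // => i _; rewrite mulr0n.
Qed.

Lemma sgD Q a b : sgset Q a -> sgset Q b -> sgset Q (a + b).
Proof.
have [n [g ->]] := sg_fg Q => -[c ->] [c' ->].
exists (fun i => c i + c' i)%N; rewrite -big_split /=.
by apply: eq_bigr => i _; rewrite mulrnDr.
Qed.

Definition sg_group Q : set 'rV[int]_d :=
  [set z | exists a b, [/\ sgset Q a, sgset Q b & z = a - b]].

Definition sg_generates Q : Prop := sg_group Q = setT.

Definition sg_normal Q : Prop :=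
  forall z n, sg_group Q z -> (0 < n)%N -> sgset Q (z *+ n) -> sgset Q z.

Definition sgelt Q : Type := set_type (sgset Q).

End Semigroup.

HB.instance Definition _ d (Q : pointedAffineSemigroup d) :=
  Choice.on (sgelt Q).

Section SemigroupMonomials.
Context {d : nat} (Q : pointedAffineSemigroup d).
Implicit Types q r : sgelt Q.

Definition sgexp q : 'rV[int]_d := val q.

Lemma sgexpP q : sgset Q (sgexp q).
Proof. exact: set_mem (valP q). Qed.

Lemma sgexp_inj : injective sgexp.
Proof. exact: val_inj. Qed.

Definition sgone : sgelt Q := exist _ 0 (mem_set (sg0 Q)).
Definition sgmul q r : sgelt Q :=
  exist _ (sgexp q + sgexp r) (mem_set (sgD (sgexpP q) (sgexpP r))).

Fact sg_mulA : associative sgmul.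
Proof. by move=> x y z; apply: sgexp_inj; rewrite /= /sgexp /= addrA. Qed.
Fact sg_mul1 : left_id sgone sgmul.
Proof. by move=> x; apply: sgexp_inj; rewrite /= /sgexp /= add0r. Qed.
Fact sg_mulr1 : right_id sgone sgmul.
Proof. by move=> x; apply: sgexp_inj; rewrite /= /sgexp /= addr0. Qed.
Fact sg_mulC : commutative sgmul.
Proof. by move=> x y; apply: sgexp_inj; rewrite /= /sgexp /= addrC. Qed.
Fact sg_unit x y : sgmul x y = sgone -> x = sgone /\ y = sgone.
Proof.
move=> xy1; have xy0 : sgexp x + sgexp y = 0 := congr1 sgexp xy1.
have xN : sgexp x = - sgexp y by apply/eqP; rewrite -addr_eq0; apply/eqP.
have x0 : sgexp x = 0.
  apply: (sg_pointed (sgexpP x)).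
  by rewrite xN opprK; apply: sgexpP.
split; apply: sgexp_inj; first exact: x0.
by apply/eqP; rewrite -[sgexp y]opprK -xN x0 oppr0.
Qed.

HB.instance Definition _ := Choice_isMonomialDef.Build (sgelt Q)
  sg_mulA sg_mul1 sg_mulr1 sg_unit.
HB.instance Definition _ := MonomialDef_isConomialDef.Build (sgelt Q) sg_mulC.

End SemigroupMonomials.

Notation "{ 'sgring' k [ Q ] }" := {malg k[sgelt Q]}
  (at level 0, k, Q at level 2, format "{ 'sgring'  k [ Q ] }") : type_scope.

Section Faces.
Context {d : nat} (Q : pointedAffineSemigroup d).

Definition is_face (F : set 'rV[int]_d) : Prop :=
  exists l : {additive 'rV[int]_d -> int},
    (forall a, sgset Q a -> 0 <= l a) /\ F = [set a | sgset Q a /\ l a = 0].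

Lemma finite_faces : finite_set [set F | is_face F].
Proof.
have [n [g Qg]] := sg_fg Q.
pose h (F : set 'rV[int]_d) : {set 'I_n} := [set i | `[< F (g i) >]]%SET.
pose u (A : {set 'I_n}) : set 'rV[int]_d :=
  [set a | exists c : 'I_n -> nat,
     (forall i, i \notin A -> c i = 0%N) /\ a = \sum_i g i *+ c i].
suff hK F : is_face F -> F = u (h F).
  apply: (@sub_finite_set _ _ (u @` setT)); last exact/finite_image/finite_finset.
  by move=> F /hK ->; exists (h F).
have Qgi i : sgset Q (g i).
  rewrite Qg; exists (fun j => (j == i) : nat); rewrite (bigD1 i) //= eqxx mulr1n.
  by rewrite big1 ?addr0 // => j /negPf ->; rewrite mulr0n.
move=> [l [l0 ->]]; apply/seteqP; split=> [a [Qa la0] | a [c [c0 ->]]].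
  have [c ac] : exists c : 'I_n -> nat, a = \sum_i g i *+ c i by move: Qa; rewrite Qg.
  exists c; split=> // i.
  rewrite inE => /asboolPn nF; apply/eqP; case: (posnP (c i)) => // ci0.
  case: nF; split; first exact: Qgi.
  move: la0; rewrite ac raddf_sum /= => /eqP.
  rewrite psumr_eq0; last first.
    by move=> j _; rewrite raddfMn mulrn_wge0 // l0.
  move=> /allP/(_ i (mem_index_enum _)) /=; rewrite raddfMn mulrn_eq0.
  by case: eqP ci0 => [->//|_ _ /eqP].
split; first by rewrite Qg; exists c.
rewrite raddf_sum big1 // => i _; rewrite raddfMn.
have [|/c0 ->] := boolP (i \in h [set a | sgset Q a /\ l a = 0]); last by rewrite mulr0n.
by rewrite inE => /asboolP [_ ->]; rewrite mul0rn.
Qed.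

(* [fset_set] is meaningful by [finite_faces]; [face_setP] and [is_faceP] show
   that the elements of [face] are exactly the faces. *)
Definition face : finType := fset_set [set F | is_face F].

Definition face_set (F : face) : set 'rV[int]_d := fsval F.

Lemma face_setP (F : face) : is_face (face_set F).
Proof. by have := fsvalP F; rewrite in_fset_set ?inE //; apply: finite_faces. Qed.

Lemma is_faceP (S : set 'rV[int]_d) :
  is_face S -> exists F : face, face_set F = S.
Proof.
move=> fS; have SF : S \in fset_set [set F | is_face F].
  by rewrite in_fset_set ?inE //; apply: finite_faces.
by exists [` SF]%fset.
Qed.

Lemma face_set_inj : injective face_set.
Proof. exact: val_inj. Qed.

End Faces.

Definition is_real_span (R : realType) d (S : set 'rV[int]_d)
    (U : {vspace 'rV[R]_d}) : Prop :=
  (forall a, S a -> map_mx intr a \in U) /\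
  (forall V : {vspace 'rV[R]_d},
     (forall a, S a -> map_mx intr a \in V) -> (U <= V)%VS).

(* The default value 0 is never taken, see [real_spanP]. *)
Definition real_span (R : realType) d (S : set 'rV[int]_d)
  : {vspace 'rV[R]_d} := xget 0%VS (is_real_span S).

Lemma real_spanP (R : realType) d (S : set 'rV[int]_d) :
  is_real_span S (real_span R S).
Proof.
pose C (V : {vspace 'rV[R]_d}) := forall a, S a -> map_mx intr a \in V.
have exC : exists n, `[< exists V, C V /\ \dim V = n >].
  exists (\dim {:'rV[R]_d}); apply/asboolP; exists fullv.
  by split=> // a _; rewrite memvf.
case: (ex_minnP exC) => n /asboolP [U [CU dU]] n_min.
rewrite /real_span; case: xgetP => [V _ //|]; move/(_ U) => [].
split=> // V CV; have UV : C (U :&: V)%VS.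
  by move=> a Sa; rewrite memv_cap CU ?CV.
have /capv_idPl // : (U :&: V = U)%VS.
apply/eqP; rewrite eqEdim capvSl dU; apply: n_min.
by apply/asboolP; exists (U :&: V)%VS.
Qed.

Section FaceComplexes.
Context (R : realType) {d : nat} {Q : pointedAffineSemigroup d}.
Implicit Types F G : face Q.

Definition face_dim F : nat := \dim (real_span R (face_set F)).

Definition subface G F : bool := `[< face_set G `<=` face_set F >].

Definition facet G F : bool :=
  subface G F && (face_dim F == (face_dim G).+1).

Definition closed_subcomplex (D : {set face Q}) : Prop :=
  forall F G, F \in D -> subface G F -> G \in D.

Definition incidence_function (eps : face Q -> face Q -> int) : Prop :=
  (forall G' G, facet G' G -> eps G' G = 1 \/ eps G' G = -1) /\
  (forall G'' G1 G2 G,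
     face_dim G = (face_dim G'').+2 ->
     face_set G'' `<` face_set G1 -> face_set G1 `<` face_set G ->
     face_set G'' `<` face_set G2 -> face_set G2 `<` face_set G ->
     G1 != G2 ->
     eps G'' G1 * eps G1 G + eps G'' G2 * eps G2 G = 0).

End FaceComplexes.

(* Membership is boolean, but arbitrary submodules are covered: a predicate
   [P] is turned into a boolean one by [`[< P >]].  Ideals of a commutative
   ring [A] are the submodules of [A^o]. *)
Record submodule (A : nzRingType) (V : lmodType A) := Submodule {
  sm_pred :> {pred V};
  sm_closed : submod_closed sm_pred
}.

HB.instance Definition _ (A : nzRingType) (V : lmodType A) (W : submodule V) :=
  GRing.isSubmodClosed.Build A V (sm_pred W) (sm_closed W).

Section QuotientModule.
Context {A : nzRingType} {V : lmodType A}.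

Definition quotmod (W : submodule V) : Type :=
  {quot GRing.ZmodClosed.clone V (sm_pred W) _}.

Variable W : submodule V.
Local Notation qW := {quot GRing.ZmodClosed.clone V (sm_pred W) _}.

HB.instance Definition _ := GRing.Zmodule.on (quotmod W).

Definition qproj (v : V) : quotmod W := \pi_qW v.

Lemma qproj_is_zmod : zmod_morphism qproj.
Proof. by move=> x y; rewrite /qproj; apply: (raddfB \pi_qW). Qed.
HB.instance Definition _ :=
  GRing.isZmodMorphism.Build V (quotmod W) qproj qproj_is_zmod.

Definition qrepr (x : quotmod W) : V := repr (x : qW).

Lemma qproj_repr (x : quotmod W) : qproj (qrepr x) = x.
Proof. exact: reprK. Qed.

Lemma qproj_eq v w : qproj v = qproj w <-> v - w \in W.
Proof. by rewrite idealrBE; split=> /eqP. Qed.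

Definition qscale (c : A) (x : quotmod W) : quotmod W :=
  qproj (c *: qrepr x).

Lemma qscaleE c v : qscale c (qproj v) = qproj (c *: v).
Proof.
apply/qproj_eq; rewrite -scalerBr rpredZ //.
by apply/qproj_eq; rewrite qproj_repr.
Qed.

Fact qscaleA a b x : qscale a (qscale b x) = qscale (a * b) x.
Proof. by rewrite -[x]qproj_repr !qscaleE scalerA. Qed.
Fact qscale1 x : qscale 1 x = x.
Proof. by rewrite -[x]qproj_repr qscaleE scale1r. Qed.
Fact qscaleDr a x y : qscale a (x + y) = qscale a x + qscale a y.
Proof.
by rewrite -[x]qproj_repr -[y]qproj_repr -raddfD !qscaleE scalerDr raddfD.
Qed.
Fact qscaleDl x a b : qscale (a + b) x = qscale a x + qscale b x.
Proof. by rewrite -[x]qproj_repr !qscaleE scalerDl raddfD. Qed.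

HB.instance Definition _ := GRing.Zmodule_isLmodule.Build A (quotmod W)
  qscaleA qscale1 qscaleDr qscaleDl.

Lemma qprojZ c v : qproj (c *: v) = c *: qproj v.
Proof. by rewrite -qscaleE. Qed.

End QuotientModule.

Section DirectSum.
Context {A : nzRingType} {J : finType} (M : J -> lmodType A).

Definition dsum : Type := {dffun forall j, M j}.
HB.instance Definition _ := Choice.on dsum.

Implicit Types x y : dsum.

Definition dsum0 : dsum := [ffun j => 0 : M j].
Definition dsumN x : dsum := [ffun j => - x j].
Definition dsumD x y : dsum := [ffun j => x j + y j].
Definition dsumZ (c : A) x : dsum := [ffun j => c *: x j].

Fact dsum_DA : associative dsumD.
Proof. by move=> x y z; apply/ffunP => j; rewrite !ffunE addrA. Qed.
Fact dsum_DC : commutative dsumD.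
Proof. by move=> x y; apply/ffunP => j; rewrite !ffunE addrC. Qed.
Fact dsum_D0 : left_id dsum0 dsumD.
Proof. by move=> x; apply/ffunP => j; rewrite !ffunE add0r. Qed.
Fact dsum_DN : left_inverse dsum0 dsumN dsumD.
Proof. by move=> x; apply/ffunP => j; rewrite !ffunE addNr. Qed.
HB.instance Definition _ := GRing.isZmodule.Build dsum dsum_DA dsum_DC dsum_D0 dsum_DN.

Fact dsum_ZA a b x : dsumZ a (dsumZ b x) = dsumZ (a * b) x.
Proof. by apply/ffunP => j; rewrite !ffunE scalerA. Qed.
Fact dsum_Z1 x : dsumZ 1 x = x.
Proof. by apply/ffunP => j; rewrite !ffunE scale1r. Qed.
Fact dsum_ZDr a x y : dsumZ a (x + y) = dsumZ a x + dsumZ a y.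
Proof. by apply/ffunP => j; rewrite !ffunE scalerDr. Qed.
Fact dsum_ZDl x a b : dsumZ (a + b) x = dsumZ a x + dsumZ b x.
Proof. by apply/ffunP => j; rewrite !ffunE scalerDl. Qed.
HB.instance Definition _ := GRing.Zmodule_isLmodule.Build A dsum dsum_ZA dsum_Z1 dsum_ZDr dsum_ZDl.

Lemma dsum0E j : (0 : dsum) j = 0. Proof. by rewrite ffunE. Qed.
Lemma dsumNE x j : (- x) j = - x j. Proof. by rewrite ffunE. Qed.
Lemma dsumDE x y j : (x + y) j = x j + y j. Proof. by rewrite ffunE. Qed.
Lemma dsumZE c x j : (c *: x) j = c *: x j. Proof. by rewrite ffunE. Qed.
Lemma dsum_sumE (I : Type) (s : seq I) (P : pred I) (E : I -> dsum) j :
  (\sum_(i <- s | P i) E i) j = \sum_(i <- s | P i) E i j.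
Proof.
by elim/big_rec2: _ => [|i y x _ <-]; rewrite ?dsum0E ?dsumDE.
Qed.

End DirectSum.

Record gradedModule (k : fieldType) d (Q : pointedAffineSemigroup d) :=
  GradedModule {
  gm_module :> lmodType {sgring k[Q]};
  gm_comp : 'rV[int]_d -> set gm_module;
  gm_comp0 : forall a, gm_comp a 0;
  gm_compB : forall a m n, gm_comp a m -> gm_comp a n -> gm_comp a (m - n);
  gm_compZ : forall (c : k) (q : sgelt Q) a m,
    gm_comp a m -> gm_comp (sgexp q + a) (<< c *g q >> *: m);
  gm_span : forall m : gm_module,
    exists (s : {fset 'rV[int]_d}) (f : 'rV[int]_d -> gm_module),
      (forall a, gm_comp a (f a)) /\ m = \sum_(a <- s) f a;
  gm_indep : forall (s : {fset 'rV[int]_d}) (f : 'rV[int]_d -> gm_module),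
    (forall a, gm_comp a (f a)) -> \sum_(a <- s) f a = 0 ->
    forall a, a \in s -> f a = 0
}.

Section GradedModuleTheory.
Context {k : fieldType} {d : nat} {Q : pointedAffineSemigroup d}.
Context (M : gradedModule k Q) (a : 'rV[int]_d).
Implicit Types m n : M.

Lemma gm_compD m n : gm_comp a m -> gm_comp a n -> gm_comp a (m + n).
Proof.
move=> ma na; rewrite -[n]opprK -[- n]add0r; apply: gm_compB => //.
by apply: gm_compB => //; apply: gm_comp0.
Qed.

Lemma gm_comp_sum (I : Type) (s : seq I) (P : pred I) (E : I -> M) :
  (forall i, P i -> gm_comp a (E i)) -> gm_comp a (\sum_(i <- s | P i) E i).
Proof.
by move=> EP; elim/big_ind: _ => //; [apply: gm_comp0 | apply: gm_compD].
Qed.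

Lemma gm_compMz m (c : int) : gm_comp a m -> gm_comp a (m *~ c).
Proof.
move=> ma; have mn (n : nat) : gm_comp a (m *+ n).
  by elim: n => [|n IH]; [apply: gm_comp0 | rewrite mulrS; apply: gm_compD].
case: c => n; first exact: mn.
rewrite NegzE mulrNz -sub0r.
by apply: gm_compB; [apply: gm_comp0 | apply: mn].
Qed.

End GradedModuleTheory.

Record gradedHom (k : fieldType) d (Q : pointedAffineSemigroup d)
    (M N : gradedModule k Q) := GradedHom {
  gh_map :> {linear M -> N};
  gh_deg : forall a m, gm_comp a m -> gm_comp a (gh_map m)
}.

Definition graded_iso (k : fieldType) d (Q : pointedAffineSemigroup d)
    (M N : gradedModule k Q) : Prop :=
  exists f : gradedHom M N, bijective f.

Section GradedDirectSum.
Context {k : fieldType} {d : nat} {Q : pointedAffineSemigroup d}.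
Context {J : finType} (M : J -> gradedModule k Q).

Definition gdsum_comp (a : 'rV[int]_d) : set (dsum M) :=
  [set x | forall j, gm_comp a (x j)].

Fact gdsum_comp0 a : gdsum_comp a 0.
Proof. by move=> j; rewrite dsum0E; apply: gm_comp0. Qed.
Fact gdsum_compB a x y : gdsum_comp a x -> gdsum_comp a y -> gdsum_comp a (x - y).
Proof. by move=> xa ya j; rewrite dsumDE dsumNE; apply: gm_compB. Qed.
Fact gdsum_compZ (c : k) (q : sgelt Q) a x :
  gdsum_comp a x -> gdsum_comp (sgexp q + a) (<< c *g q >> *: x).
Proof. by move=> xa j; rewrite dsumZE; apply: gm_compZ. Qed.

Fact gdsum_indep (s : {fset 'rV[int]_d}) (f : 'rV[int]_d -> dsum M) :
  (forall a, gdsum_comp a (f a)) -> \sum_(a <- s) f a = 0 ->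
  forall a, a \in s -> f a = 0.
Proof.
move=> fP f0 a sa; apply/ffunP => j; rewrite dsum0E.
apply: (gm_indep (s := s) (f := fun b => f b j)) => //.
  by move=> b; apply: fP.
by rewrite -dsum_sumE f0 dsum0E.
Qed.

Fact gdsum_span (x : dsum M) :
  exists (s : {fset 'rV[int]_d}) (f : 'rV[int]_d -> dsum M),
    (forall a, gdsum_comp a (f a)) /\ x = \sum_(a <- s) f a.
Proof.
have [s sP] := choice (fun j => gm_span (x j)).
pose f j := sval (cid (sP j)); have fP j := svalP (cid (sP j)).
pose s' := (\bigcup_(j <- enum J) s j)%fset.
exists s', (fun a => [ffun j : J => if a \in s j then f j a else 0]); split.
  by move=> a j; rewrite ffunE; case: ifP => _; [apply: (fP j).1 | apply: gm_comp0].
apply/ffunP => j; rewrite dsum_sumE (fP j).2.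
rewrite -[RHS](@big_fset_incl _ _ _ _ (s j)); first last.
- by move=> a _ /negPf; rewrite ffunE => ->.
- by apply: bigfcup_sup => //; rewrite mem_enum.
by apply: eq_big_seq => a sa; rewrite ffunE sa.
Qed.

Definition gdsum : gradedModule k Q :=
  GradedModule gdsum_comp0 gdsum_compB gdsum_compZ gdsum_span gdsum_indep.

End GradedDirectSum.

Notation "''Ideal_' ( k , Q )" :=
  (@submodule {malg k[sgelt Q]} ({malg k[sgelt Q]}^o))
  (at level 8, format "''Ideal_' ( k ,  Q )") : type_scope.

Record gradedIdeal (k : fieldType) d (Q : pointedAffineSemigroup d) :=
  GradedIdeal {
  gi_ideal :> 'Ideal_(k, Q);
  gi_graded : forall (f : {sgring k[Q]}) (q : sgelt Q),
    f \in gi_ideal -> << f@_q *g q >> \in gi_ideal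
}.

(* The competing ideals [I] and [J] need not be graded. *)
Definition irreducible_ideal (k : fieldType) d (Q : pointedAffineSemigroup d)
    (W : 'Ideal_(k, Q)) : Prop :=
  ~ exists I J : 'Ideal_(k, Q),
      [/\ {subset W <= I} /\ ~ {subset I <= W},
          {subset W <= J} /\ ~ {subset J <= W} &
          forall f, (f \in W) = (f \in I) && (f \in J)].

Section GradedQuotient.
Context {k : fieldType} {d : nat} {Q : pointedAffineSemigroup d}.
Variable W : gradedIdeal k Q.

(* The images of [c x^a], which vanish when [a] is not in [Q]. *)
Definition gquot_comp (a : 'rV[int]_d) : set (quotmod W) :=
  [set x | exists f : {sgring k[Q]},
     (forall q, q \in msupp f -> sgexp q = a) /\ x = qproj W f].

Fact gquot_comp0 a : gquot_comp a 0.
Proof.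
by exists 0; split; [move=> q; rewrite msupp0 inE | rewrite raddf0].
Qed.
Fact gquot_compB a x y : gquot_comp a x -> gquot_comp a y -> gquot_comp a (x - y).
Proof.
move=> [f [fa ->]] [g [ga ->]]; exists (f - g); split; last by rewrite raddfB.
move=> q /(fsubsetP (msuppB_le f g)); rewrite in_fsetU => /orP[] ?.
  exact: fa.
exact: ga.
Qed.
Fact gquot_compZ (c : k) (q : sgelt Q) a x :
  gquot_comp a x -> gquot_comp (sgexp q + a) (<< c *g q >> *: x).
Proof.
move=> [f [fa ->]]; exists (<< c *g q >> * f); split; last exact: esym (qprojZ W _ f).
move=> r /msuppM_le [q1 [q2 []]].
by move=> /(fsubsetP msuppU_le); rewrite in_fset1 => /eqP -> /fa <- ->.
Qed.

Fact gquot_span (x : quotmod W) :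
  exists (s : {fset 'rV[int]_d}) (f : 'rV[int]_d -> quotmod W),
    (forall a, gquot_comp a (f a)) /\ x = \sum_(a <- s) f a.
Proof.
rewrite -[x]qproj_repr; set f : {sgring k[Q]} := qrepr x.
pose h a : {sgring k[Q]} := \sum_(q <- msupp f | sgexp q == a) << f@_q *g q >>.
exists [fset sgexp q | q in msupp f]%fset, (fun a => qproj W (h a)); split.
  move=> a; exists (h a); split=> // q; apply: contraTeq => qa.
  rewrite -mcoeff_eq0 raddf_sum /= big1 // => r /eqP ra; rewrite mcoeffU.
  by case: eqP => // rq; rewrite -ra rq eqxx in qa.
rewrite -raddf_sum; congr qproj.
rewrite big_imfset /=; last by move=> q r _ _ /sgexp_inj.
rewrite [LHS]monalgE; apply: eq_big_seq => q qf.
rewrite /h big_mkcond /= (big_fsetD1 q) //= eqxx big1_fset ?addr0 // => r.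
by rewrite in_fsetD1 => /andP[/eqP rq _] _; case: eqP => // /sgexp_inj.
Qed.

Fact gquot_indep (s : {fset 'rV[int]_d}) (f : 'rV[int]_d -> quotmod W) :
  (forall a, gquot_comp a (f a)) -> \sum_(a <- s) f a = 0 ->
  forall a, a \in s -> f a = 0.
Proof.
move=> /choice[g gP] f0 a sa; have [ga fa] := gP a.
rewrite fa -[RHS](raddf0 (qproj W)); apply/qproj_eq; rewrite subr0.
have gW : \sum_(b <- s) g b \in W.
  rewrite -[X in X \in _]subr0; apply/qproj_eq; rewrite raddf0 raddf_sum -[RHS]f0.
  by apply: eq_bigr => b _; rewrite (gP b).2.
have gE q : sgexp q = a -> (\sum_(b <- s) g b)@_q = (g a)@_q.
  move=> qa; rewrite raddf_sum (big_fsetD1 a) //= big1_fset ?addr0 // => b.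
  rewrite in_fsetD1 => /andP[/eqP ba _] _; apply/eqP; rewrite mcoeff_eq0.
  by apply: contra_notN ba => /(gP b).1 <-.
have [/eqP|/fset0Pn[q qg]] := eqVneq (msupp (g a)) fset0.
  by rewrite msupp_eq0 => /eqP ->; apply: rpred0.
have -> : g a = << (g a)@_q *g q >>.
  rewrite [LHS]monalgE (_ : msupp (g a) = [fset q]%fset) ?big_seq_fset1 //.
  apply/fsetP => r; rewrite in_fset1; apply/idP/eqP => [rg|-> //].
  by apply: sgexp_inj; rewrite (ga _ qg) (ga _ rg).
by rewrite -gE ?ga //; apply: gi_graded.
Qed.

Definition gquot : gradedModule k Q :=
  GradedModule gquot_comp0 gquot_compB gquot_compZ gquot_span gquot_indep.

End GradedQuotient.

Section QuotientMap.
Context {A : nzRingType} {V : lmodType A} (W W' : submodule V).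

(* The natural surjection V/W -> V/W' when W is contained in W'. *)
Definition qmap (x : quotmod W) : quotmod W' := qproj W' (qrepr x).

Lemma qmapE v : {subset W <= W'} -> qmap (qproj W v) = qproj W' v.
Proof.
move=> WW'; apply/qproj_eq/WW'/qproj_eq; exact: qproj_repr.
Qed.

Lemma qmapZD c x y : {subset W <= W'} -> qmap (c *: x + y) = c *: qmap x + qmap y.
Proof.
move=> WW'; rewrite -[x]qproj_repr -[y]qproj_repr -qprojZ -raddfD !qmapE //.
by rewrite raddfD /= qprojZ.
Qed.

End QuotientMap.

(* Consecutive maps are not required to compose to zero here; this is part of
   the exactness below. *)
Record gradedSequence (k : fieldType) d (Q : pointedAffineSemigroup d) :=
  GradedSequence {
  gs_obj : int -> gradedModule k Q;
  gs_diff : forall i, gradedHom (gs_obj i) (gs_obj (i + 1))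
}.

Definition irreducible_resolution (k : fieldType) d
    (Q : pointedAffineSemigroup d) (M : gradedModule k Q)
    (C : gradedSequence k Q) : Prop :=
  [/\ forall i, i < 0 -> forall x : gs_obj C i, x = 0,
      forall i, 0 <= i -> exists (mu : nat) (W : 'I_mu -> gradedIdeal k Q),
        (forall j, irreducible_ideal (W j)) /\
        graded_iso (gs_obj C i) (gdsum (fun j => gquot (W j))) &
      exists eta : gradedHom M (gs_obj C 0),
        [/\ injective eta,
            forall x, gs_diff C 0 x = 0 <-> exists m, x = eta m &
            forall i, 0 <= i -> forall x,
              gs_diff C (i + 1) x = 0 <-> exists y, x = gs_diff C i y]].

Section FaceIdeals.
Context (k : fieldType) {d : nat} {Q : pointedAffineSemigroup d}.

(* The k-span of the monomials whose exponents lie on no face of [D]: this is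
   the ideal I_D when [D] is a subcomplex, and the ideal of k[Q] with quotient
   k[G] when [D] is [set G]. *)
Definition off_faces (D : {set face Q}) : pred {sgring k[Q]}^o :=
  fun f => `[< forall q, q \in msupp (f : {sgring k[Q]}) ->
               forall F, F \in D -> ~ face_set F (sgexp q) >].

Lemma off_faces_closed D : submod_closed (off_faces D).
Proof.
split=> [|c f g]; first by apply/asboolP => q; rewrite msupp0 inE.
move=> /asboolP fD /asboolP gD; apply/asboolP => q.
move=> /(fsubsetP (msuppD_le _ _)); rewrite in_fsetU => /orP[|/gD //].
move=> /msuppM_le [q1 [q2 [_ /fD q2D ->]]] F FD.
have [l [l0 FE]] := face_setP F; move: (q2D F FD); rewrite FE => nF.
apply: contra_not nF => -[_] /=; rewrite /sgexp /= raddfD => /eqP.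
have [l1 l2] := (l0 _ (sgexpP q1), l0 _ (sgexpP q2)).
rewrite paddr_eq0 // => /andP[_ /eqP l20]; split=> //; exact: sgexpP.
Qed.

Lemma off_faces_sub (G G' : face Q) : subface G' G ->
  {subset off_faces [set G]%SET <= off_faces [set G']%SET}.
Proof.
move=> /asboolP GG' f /asboolP fG; apply/asboolP => q /fG qG F.
rewrite finset.in_set1 => /eqP -> /GG'; apply: qG; exact: finset.set11.
Qed.

Lemma off_faces_graded D (f : {sgring k[Q]}) q :
  f \in off_faces D -> << f@_q *g q >> \in off_faces D.
Proof.
move=> /asboolP fD; apply/asboolP => r; rewrite msuppU.
case: eqP => [_|/eqP]; first by rewrite inE.
by rewrite mcoeff_neq0 in_fset1 => /fD qD /eqP ->.
Qed.

Definition complex_ideal (D : {set face Q}) : gradedIdeal k Q :=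
  @GradedIdeal k d Q (Submodule (off_faces_closed D)) (@off_faces_graded D).

Definition face_ring (G : face Q) : gradedModule k Q :=
  gquot (complex_ideal [set G]%SET).

Definition face_res (G G' : face Q) : face_ring G -> face_ring G' :=
  @qmap _ _ (complex_ideal [set G]%SET) (complex_ideal [set G']%SET).

End FaceIdeals.

Section Zeeman.
Context (R : realType) (k : fieldType) {d : nat} {Q : pointedAffineSemigroup d}.
Variables (D : {set face Q}) (eps : face Q -> face Q -> int).

(* The pair (F, G) stands for the generator F (x) e_G; the summand
   kF (x) k[G] is k[G]. *)
Definition zeeman_p (s : face Q * face Q) : int := (face_dim R s.1)%:Z.
Definition zeeman_q (s : face Q * face Q) : int := - (face_dim R s.2)%:Z.

Definition zeeman_index (i : int) (s : face Q * face Q) : bool :=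
  [&& s.1 \in D, s.2 \in D, subface s.2 s.1 & zeeman_p s + zeeman_q s == i].

Definition zeeman_pair (i : int) : finType := {s | zeeman_index i s}.

Definition zeeman_tot (i : int) : gradedModule k Q :=
  gdsum (fun s : zeeman_pair i => face_ring k (val s).2).

(* Coefficients of the generator t in the images of the generator s = (F, G):
     vertical    F (x) e_G |-> sum over facets G' of G of eps(G', G) F (x) e_G',
     horizontal  F (x) e_G |-> (-1)^q sum over F' in D having F as a facet of
                               eps(F, F') F' (x) e_G. *)
Definition vert_coef (s t : face Q * face Q) : int :=
  if (t.1 == s.1) && facet R t.2 s.2 then eps t.2 s.2 else 0.

Definition horiz_coef (s t : face Q * face Q) : int :=
  if (t.2 == s.2) && facet R s.1 t.1
  then (-1) ^ zeeman_q s * eps s.1 t.1 else 0.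

Definition zeeman_diff_fun i (x : zeeman_tot i) : zeeman_tot (i + 1) :=
  [ffun t : zeeman_pair (i + 1) =>
     \sum_(s : zeeman_pair i)
       face_res (val t).2 (x s) *~
         (horiz_coef (val s) (val t) + vert_coef (val s) (val t))]
     : dsum (fun t : zeeman_pair (i + 1) => face_ring k (val t).2).

Lemma zeeman_coef_sub (s t : face Q * face Q) :
  horiz_coef s t + vert_coef s t != 0 -> subface t.2 s.2.
Proof.
rewrite /horiz_coef /vert_coef; case: ifP => [/andP[/eqP -> _] _|_].
  exact/asboolP.
by case: ifP => [/andP[_ /andP[]]|]; rewrite ?addr0 ?eqxx.
Qed.

Lemma zeeman_diff_linear i : linear (@zeeman_diff_fun i).
Proof.
move=> c x y; apply/ffunP => t; rewrite dsumDE dsumZE !ffunE.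
rewrite scaler_sumr -big_split /=; apply: eq_bigr => s _.
have [->|/zeeman_coef_sub ts] :=
  eqVneq (horiz_coef (val s) (val t) + vert_coef (val s) (val t)) 0.
  by rewrite !mulr0z scaler0 addr0.
rewrite dsumDE dsumZE -scalerMzr -mulrzDl; congr (_ *~ _).
exact/qmapZD/off_faces_sub.
Qed.
HB.instance Definition _ i :=
  GRing.isLinear.Build {sgring k[Q]} (zeeman_tot i) (zeeman_tot (i + 1)) _
    (@zeeman_diff_fun i) (@zeeman_diff_linear i).

Lemma zeeman_diff_deg i a (x : zeeman_tot i) :
  gm_comp a x -> gm_comp a (zeeman_diff_fun x).
Proof.
move=> xa t; rewrite ffunE; apply: gm_comp_sum => s _.
have [->|/zeeman_coef_sub ts] :=
  eqVneq (horiz_coef (val s) (val t) + vert_coef (val s) (val t)) 0.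
  by rewrite mulr0z; apply: gm_comp0.
apply: gm_compMz; have [f [fa ->]] := xa s.
exists f; split=> //; exact/qmapE/off_faces_sub.
Qed.

Definition zeeman_diff i : gradedHom (zeeman_tot i) (zeeman_tot (i + 1)) :=
  GradedHom (gh_map := @zeeman_diff_fun i) (@zeeman_diff_deg i).

Definition tot_zeeman : gradedSequence k Q := GradedSequence zeeman_diff.

End Zeeman.

(* Main.v *)
(* In degree [a] of [Q], with [A] the minimal face containing [a], the total
   complex has basis the pairs [(F, G)] with [A <= G <= F] in [D].  Filtering by
   [F], its layers are the cellular complexes of the intervals [[A, F]], which
   are acyclic for [A != F]; only the pair [(A, A)] is left, and it carries the
   degree [a] part of [k[Q]/I_D].

   Acyclicity of the intervals is proved for all sets of "tangent faces"
   [T_x(F) = {G <= F | x in F - G}] with [x] in the span of [F] but not in minus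
   its relative interior ([[A, F]] is the case of [- x] in the relative interior
   of [A]).  When [x] moves along a generic line towards minus the interior of
   [F], the set changes only at the hyperplanes spanned by facets [H] of [F],
   where it loses [T_y(H)], [y] being the crossing point.  By induction [T_x(F)]
   is filtered with two-element layers [{F, H}], [H] a facet of [F].  The same
   filtration gives the Euler characteristic, hence the existence of exactly two
   faces between faces whose dimensions differ by two, and with it
   [d \o d = 0].

   Each [k[G]] is a domain, so the ideals involved are prime, hence irreducible. *)

From HB Require Import structures.
Require Import Defs.
From mathcomp Require Import all_boot all_order all_algebra finmap.
From mathcomp Require Import boolp classical_sets reals monalg.
From mathcomp Require Import zify ring lra.

Set Implicit Arguments.
Unset Strict Implicit.
Unset Printing Implicit Defensive.

Import Order.TTheory GRing.Theory Num.Theory.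

Local Open Scope ring_scope.

(** * Acyclic matchings *)

Lemma big_set_disjU (V : nmodType) (X : finType) (S1 S2 : {set X}) (F : X -> V) :
  [disjoint S1 & S2] ->
  \sum_(s in S1 :|: S2) F s = \sum_(s in S1) F s + \sum_(s in S2) F s.
Proof. by move=> dS; rewrite -bigU //; apply: eq_bigl => s; rewrite !inE. Qed.

Section Matched.
Context {X : finType}.
Implicit Types (e : rel X) (S : {set X}).

(* In algebraic terms, a filtration whose layers are two-term complexes with
   an invertible arrow. *)
Inductive matched e : {set X} -> Prop :=
| matched0 : matched e finset.set0
| matched_pair s t : e s t -> matched e [set s; t]%SET
| matchedU S1 S2 : matched e S1 -> matched e S2 -> [disjoint S1 & S2] ->
    (forall s t, s \in S1 -> t \in S2 -> ~~ e s t) -> matched e (S1 :|: S2).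

(** An arrow leaving a fiber of [p] raises [r], so within [S] no arrow leaves the fiber over a value
    with [r] maximal. That fiber is split off first; induction on the number of values of [p]. *)
Lemma matched_fibers (Y : finType) e S (p : X -> Y) (r : Y -> nat) :
  (forall s t, e s t -> p s = p t \/ (r (p s) < r (p t))%N) ->
  (forall y, matched e [set s in S | p s == y]) -> matched e S.
Proof.
move=> er; have [n] := ubnP #|p @: S|; elim: n S => // n IH S Sn fib.
have [->|/finset.set0Pn[s0 s0S]] := eqVneq S finset.set0; first exact: matched0.
have /(@arg_maxnP _ _ _ r) [y yS ymax] : p s0 \in p @: S by apply: imset_f.
have -> : S = [set s in S | p s == y] :|: [set s in S | p s != y].
  by apply/setP => s; rewrite !inE -andb_orr orbN andbT.
apply: matchedU => //.
- apply: IH => [|z].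
    rewrite -ltnS; apply: leq_trans Sn; rewrite ltnS; apply: proper_card.
    apply/properP; split.
      by apply/fintype.subsetP => z /imsetP[s]; rewrite inE => /andP[sS _] ->; apply: imset_f.
    by exists y => //; apply/imsetP => -[s]; rewrite inE => /andP[_ /eqP]; apply: nesym.
  have [->|zy] := eqVneq z y.
    have -> : [set s in [set s in S | p s != y] | p s == y] = finset.set0.
      by apply/setP => s; rewrite !inE -andbA andNb andbF.
    exact: matched0.
  suff -> : [set s in [set s in S | p s != y] | p s == z] = [set s in S | p s == z] by [].
  by apply/setP => s; rewrite !inE; case: (p s =P z) => [->|]; rewrite ?zy ?andbT ?andbF.
- by rewrite disjoint_subset; apply/fintype.subsetP => s; rewrite !inE => /andP[-> ->].
- move=> s t; rewrite !inE => /andP[_ /eqP ps] /andP[tS pt]; apply/negP => /er[].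
    by rewrite ps => yt; rewrite -yt eqxx in pt.
  by rewrite ps ltnNge => /negP; apply; apply/ymax/imset_f.
Qed.

(** Vanishing of an Euler characteristic: the two members of each matched pair cancel. *)
Lemma matched_sum_sign e S (n : X -> nat) :
  (forall s t, e s t -> n s = (n t).+1) -> matched e S ->
  \sum_(s in S) (-1) ^+ n s = 0 :> int.
Proof.
move=> en; elim=> [|s t st|S1 S2 _ IH1 _ IH2 dS _].
- by rewrite big_set0.
- have /en nst := st; rewrite big_setU1 ?inE ?big_set1 /=.
    by rewrite nst exprS mulN1r addNr.
  by apply/eqP => tE; move: nst; rewrite tE; lia.
- by rewrite big_set_disjU // IH1 IH2 addr0.
Qed.

End Matched.

Lemma matched_imset (X Y : finType) (e : rel X) (e' : rel Y) (f : X -> Y) S :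
  injective f -> (forall s t, e' (f s) (f t) = e s t) ->
  matched e S -> matched e' (f @: S).
Proof.
move=> finj ee'; elim=> [|s t st|S1 S2 _ IH1 _ IH2 dS arr].
- by rewrite imset0; apply: matched0.
- by rewrite imsetU1 imset_set1; apply: matched_pair; rewrite ee'.
- rewrite imsetU; apply: matchedU => //.
    by rewrite imset_disjoint //; apply: in2W.
  by move=> _ _ /imsetP[s sS ->] /imsetP[t tS ->]; rewrite ee' arr.
Qed.

(** * Acyclicity of matched complexes *)

Section Acyclic.
Context {k : fieldType} {X : finType} (c : X -> X -> k).
Implicit Types (S : {set X}) (x y : X -> k).

(** The matrix [c] acts on row vectors indexed by [S], without any grading; degrees are reinstated
    only in [zeeman_fiber_exact]. *)
Definition is_complex S := forall s u, s \in S -> u \in S ->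
  \sum_(t in S) c s t * c t u = 0.

Definition acyclic S := forall x,
  (forall t, t \in S -> \sum_(s in S) x s * c s t = 0) ->
  exists y, forall t, t \in S -> x t = \sum_(s in S) y s * c s t.

(** [S1] is a subcomplex with quotient [S2]: a path of two arrows with both ends in one part cannot
    pass through the other. *)
Lemma is_complexU S1 S2 : [disjoint S1 & S2] ->
  (forall s t, s \in S1 -> t \in S2 -> c s t = 0) ->
  is_complex (S1 :|: S2) -> is_complex S1 /\ is_complex S2.
Proof.
move=> dS arr cS; split=> s u sS uS.
  have := cS s u; rewrite !inE sS uS big_set_disjU //= => /(_ isT isT).
  by rewrite [X in _ + X]big1 ?addr0 // => t tS; rewrite arr ?mul0r.
have := cS s u; rewrite !inE sS uS !orbT big_set_disjU //= => /(_ isT isT).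
by rewrite big1 ?add0r // => t tS; rewrite (arr t u) ?mulr0.
Qed.

(** The cycle is first solved in the quotient [S2]; subtracting the boundary [b] of that solution
    leaves a cycle of [S1], which is solved there. *)
Lemma acyclicU S1 S2 : [disjoint S1 & S2] ->
  (forall s t, s \in S1 -> t \in S2 -> c s t = 0) ->
  is_complex (S1 :|: S2) -> acyclic S1 -> acyclic S2 -> acyclic (S1 :|: S2).
Proof.
move=> dS arr cS a1 a2 x xc.
have [|y2 y2P] := a2 x.
  move=> t tS; have := xc t; rewrite inE tS orbT big_set_disjU // => /(_ isT).
  by rewrite big1 ?add0r // => s sS; rewrite arr ?mulr0.
pose b t := \sum_(s in S2) y2 s * c s t.
have [|y1 y1P] := a1 (fun t => x t - b t).
  move=> u uS; have uSS : u \in S1 :|: S2 by rewrite inE uS.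
  have := xc u uSS; rewrite big_set_disjU //.
  have -> : \sum_(s in S2) x s * c s u = \sum_(s in S2) b s * c s u.
    by apply: eq_bigr => s sS; rewrite y2P.
  move=> /eqP; rewrite addr_eq0 => /eqP xE.
  under eq_bigr => s _ do rewrite mulrBl.
  rewrite sumrB xE -opprD addrC -big_set_disjU //; apply/eqP; rewrite oppr_eq0; apply/eqP.
  under eq_bigr => t _ do rewrite /b mulr_suml.
  rewrite exchange_big /= big1 // => s sS.
  under eq_bigr => t _ do rewrite -mulrA.
  by rewrite -mulr_sumr cS ?mulr0 // inE sS orbT.
exists (fun s => if s \in S1 then y1 s else y2 s) => t.
have yE : \sum_(s in S1 :|: S2) (if s \in S1 then y1 s else y2 s) * c s t =
    \sum_(s in S1) y1 s * c s t + b t.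
  rewrite big_set_disjU //; congr (_ + _); apply: eq_bigr => s sS; first by rewrite sS.
  by rewrite (disjointFl dS sS).
rewrite yE !inE; case/orP=> tS; first by rewrite -y1P // subrK.
by rewrite y2P // [X in _ = X + _]big1 ?add0r // => s sS; rewrite arr ?mulr0.
Qed.

(** Antisymmetry excludes loops and double arrows, so a matched pair is a two-term complex whose
    single arrow is invertible over the field [k]. *)
Lemma matched_acyclic S : (forall s t, c s t != 0 -> c t s = 0) ->
  matched (fun s t => c s t != 0) S -> is_complex S -> acyclic S.
Proof.
move=> anti; elim=> [_|s t st _|S1 S2 _ IH1 _ IH2 dS arr cS].
- by move=> x _; exists (fun=> 0) => t; rewrite inE.
- have diag r : c r r = 0 by apply: contrapT => /eqP rr; move: (rr); rewrite (anti _ _ rr) eqxx.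
  have ts : s != t by apply: contraNneq st => ->; rewrite diag.
  move=> x; have E (z : X -> k) r : \sum_(q in [set s; t]%SET) z q * c q r = z s * c s r + z t * c t r.
    by rewrite big_setU1 ?inE // big_set1.
  move=> xc; have := xc t; rewrite E diag mulr0 addr0 !inE eqxx orbT => /(_ isT)/eqP.
  rewrite mulf_eq0 (negPf st) orbF => /eqP xs0.
  exists (fun=> x t / c s t) => r; rewrite E !inE => /orP[] /eqP ->.
    by rewrite diag (anti _ _ st) !mulr0 addr0.
  by rewrite diag mulr0 addr0 divfK.
have arr0 s t : s \in S1 -> t \in S2 -> c s t = 0.
  by move=> sS tS; apply/eqP/negPn/arr.
have [c1 c2] := is_complexU dS arr0 cS.
by apply: acyclicU => //; [apply: IH1 | apply: IH2].
Qed.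

End Acyclic.

(** * Halfspace descriptions of cones *)

(** Counting [0] among the values gives a maximum even for an empty list, and a nonnegative one. *)
Lemma seq_max_ge0 (R : realFieldType) (T : eqType) (s : seq T) (r : T -> R) :
  exists t, [/\ 0 <= t, forall x, x \in s -> r x <= t &
    t = 0 \/ exists2 x, x \in s & t = r x].
Proof.
elim: s => [|x s [t [t0 tmax tE]]]; first by exists 0; split=> //; left.
have [rt|/ltW rt] := leP (r x) t.
  exists t; split=> //; first by move=> z /[!inE] /orP[/eqP ->|/tmax].
  by case: tE => [->|[z zs ->]]; [left | right; exists z; rewrite // inE zs orbT].
exists (r x); split; first exact: le_trans rt.
  by move=> z /[!inE] /orP[/eqP ->//|/tmax /le_trans]; apply.
by right; exists x; rewrite ?inE ?eqxx.
Qed.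

Section Evaluation.
Context {R : realType} {d : nat}.
Implicit Types (y z : 'rV[R]_d) (a : 'rV[int]_d).

Definition ev (h : 'cV[R]_d) y : R := (y *m h) 0 0.

Lemma evD h y z : ev h (y + z) = ev h y + ev h z.
Proof. by rewrite /ev mulmxDl mxE. Qed.
Lemma evZ h c y : ev h (c *: y) = c * ev h y.
Proof. by rewrite /ev -scalemxAl mxE. Qed.
Lemma evN h y : ev h (- y) = - ev h y.
Proof. by rewrite /ev mulNmx mxE. Qed.
Lemma evB h y z : ev h (y - z) = ev h y - ev h z.
Proof. by rewrite evD evN. Qed.
Lemma ev0 h : ev h 0 = 0.
Proof. by rewrite /ev mul0mx mxE. Qed.
Lemma ev_sum h (I : Type) (s : seq I) (P : pred I) (F : I -> 'rV[R]_d) :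
  ev h (\sum_(i <- s | P i) F i) = \sum_(i <- s | P i) ev h (F i).
Proof. by elim/big_rec2: _ => [|i u v _ <-]; rewrite ?ev0 ?evD. Qed.
Lemma evDl h h' y : ev (h + h') y = ev h y + ev h' y.
Proof. by rewrite /ev mulmxDr mxE. Qed.
Lemma evZl h c y : ev (c *: h) y = c * ev h y.
Proof. by rewrite /ev -scalemxAr mxE. Qed.
Lemma evNl h y : ev (- h) y = - ev h y.
Proof. by rewrite /ev mulmxN mxE. Qed.
Lemma evBl h h' y : ev (h - h') y = ev h y - ev h' y.
Proof. by rewrite evDl evNl. Qed.

Definition toR a : 'rV[R]_d := map_mx intr a.
Definition covR (h : 'cV[int]_d) : 'cV[R]_d := map_mx intr h.

Lemma toRD a b : toR (a + b) = toR a + toR b. Proof. exact: map_mxD. Qed.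
Lemma toR0 : toR 0 = 0. Proof. exact: map_mx0. Qed.
Lemma toR_sum (I : Type) (s : seq I) (P : pred I) (F : I -> 'rV[int]_d) :
  toR (\sum_(i <- s | P i) F i) = \sum_(i <- s | P i) toR (F i).
Proof. by elim/big_rec2: _ => [|i u v _ <-]; rewrite ?toR0 ?toRD. Qed.
Lemma toRMn a n : toR (a *+ n) = n%:R *: toR a.
Proof. by rewrite scaler_nat /toR raddfMn. Qed.

Lemma ev_toR (h : 'cV[int]_d) a : ev (covR h) (toR a) = ((a *m h) 0 0)%:~R.
Proof. by rewrite /ev -map_mxM mxE. Qed.

Definition cov_of (l : 'rV[int]_d -> int) : 'cV[int]_d := \col_i l (delta_mx 0 i).

Lemma cov_ofE (l : {additive 'rV[int]_d -> int}) a : (a *m cov_of l) 0 0 = l a.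
Proof.
rewrite mxE [in RHS](row_sum_delta a) raddf_sum; apply: eq_bigr => i _.
rewrite mxE -[in RHS](intz (a 0 i)) scaler_int raddfMz -mulrzl.
by rewrite intz.
Qed.

Definition cov_fun (h : 'cV[int]_d) a : int := (a *m h) 0 0.

Fact cov_fun_is_zmod_morphism h : zmod_morphism (cov_fun h).
Proof. by move=> a b; rewrite /cov_fun mulmxBl !mxE. Qed.
HB.instance Definition _ h :=
  GRing.isZmodMorphism.Build 'rV[int]_d int (cov_fun h) (cov_fun_is_zmod_morphism h).

(** Generators are indexed by [nat], so that an induction on [n] keeps the same [g]. *)
Definition cone n (g : nat -> 'rV[int]_d) y : Prop :=
  exists2 c : nat -> R, forall j, 0 <= c j & y = \sum_(j < n) c j *: toR (g j).

(* Fourier-Motzkin elimination, one generator at a time. *)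
Lemma cone_halfspaces n (g : nat -> 'rV[int]_d) :
  exists hs : seq 'cV[int]_d, forall y,
    cone n g y <-> forall h, h \in hs -> 0 <= ev (covR h) y.
Proof.
elim: n => [|n [hs hsP]].
  (* The cone without generators is the origin, cut out by the coordinates and their opposites. *)
  exists ([seq delta_mx i 0 | i <- enum 'I_d] ++ [seq - delta_mx i 0 | i <- enum 'I_d]) => y.
  have evd i : ev (covR (delta_mx i 0)) y = y 0 i.
    rewrite /ev /covR map_delta_mx mxE (bigD1 i) //= !mxE !eqxx mulr1.
    by rewrite big1 ?addr0 // => j /negPf ji; rewrite !mxE ji mulr0.
  split=> [[c _ ->] h _|H]; first by rewrite big_ord0 ev0.
  exists (fun=> 0) => //; rewrite big_ord0; apply/rowP => i; rewrite mxE; apply/eqP.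
  rewrite eq_le -oppr_ge0 -evd -evNl /covR -map_mxN.
  by apply/andP; split; apply: H; rewrite mem_cat; apply/orP; [right | left];
    apply: map_f; rewrite mem_enum.
pose u (h : 'cV[int]_d) : int := (g n *m h) 0 0.
have uE (h : 'cV[int]_d) : ev (covR h) (toR (g n)) = (u h)%:~R := ev_toR h (g n).
pose comb (h h' : 'cV[int]_d) : 'cV[int]_d := u h *: h' - u h' *: h.
have combE h h' y : ev (covR (comb h h')) y =
    (u h)%:~R * ev (covR h') y - (u h')%:~R * ev (covR h) y.
  by rewrite /covR /comb map_mxB !map_mxZ evBl !evZl.
(* The new inequalities are the old ones nonnegative on [g n], and the positive combinations of a
   positive and a negative one that vanish on [g n]. *)
exists ([seq h <- hs | 0 <= u h] ++
        [seq comb h h' | h <- [seq h <- hs | 0 < u h], h' <- [seq h <- hs | u h < 0]]) => y.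
split.
  case=> c c0 yE; pose y0 := \sum_(j < n) c j *: toR (g j).
  have y0P : forall h, h \in hs -> 0 <= ev (covR h) y0 by apply/hsP; exists c.
  have {}yE : y = y0 + c n *: toR (g n) by rewrite yE big_ord_recr.
  move=> h; rewrite mem_cat => /orP[|/allpairsP[[p q] /= []]].
    rewrite mem_filter => /andP[uh hhs]; rewrite yE evD evZ uE.
    by rewrite addr_ge0 ?y0P // mulr_ge0 // ler0z.
  rewrite !mem_filter => /andP[up phs] /andP[uq qhs] ->.
  rewrite combE yE !evD !evZ !uE.
  have -> : forall a b e f t : R, a * (e + t * b) - b * (f + t * a) = a * e + (- b) * f.
    by move=> *; ring.
  by rewrite addr_ge0 // mulr_ge0 ?y0P ?oppr_ge0 ?lerz0 ?ler0z // ltW.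
move=> H.
(* [t] is the coefficient of [g n]: the least nonnegative value for which [y - t *: toR (g n)]
   satisfies the inequalities negative on [g n]. The combinations ensure that those positive on
   [g n] still hold. *)
have [t [t0 tmax tE]] := seq_max_ge0 [seq h <- hs | u h < 0]
  (fun h => ev (covR h) y / (u h)%:~R).
have : cone n g (y - t *: toR (g n)).
  apply/hsP => h hhs; rewrite evB evZ uE subr_ge0.
  have [uh|uh|uh] := ltgtP (u h) 0.
  - by rewrite -ler_ndivrMr ?ltrz0 // tmax // mem_filter uh.
  - have evh : 0 <= ev (covR h) y by apply: H; rewrite mem_cat mem_filter ltW ?hhs.
    case: tE => [->|[q]]; first by rewrite mul0r.
    rewrite mem_filter => /andP[uq qhs] ->.
    have : comb h q \in [seq comb h h' | h <- [seq h <- hs | 0 < u h], h' <- [seq h <- hs | u h < 0]].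
      by apply/allpairsP; exists (h, q); rewrite !mem_filter /= uh hhs uq qhs.
    move=> hq; have := H (comb h q); rewrite mem_cat hq orbT combE subr_ge0 => /(_ isT).
    by move=> le; rewrite mulrAC ler_ndivrMr ?ltrz0 // [X in X <= _]mulrC [X in _ <= X]mulrC.
  - by rewrite uh mulr0 H // mem_cat mem_filter uh hhs.
move=> [c c0 cE]; exists (fun j => if j == n then t else c j).
  by move=> j; case: eqP.
rewrite big_ord_recr /= eqxx -[LHS](subrK (t *: toR (g n))) cE; congr (_ + _).
by apply: eq_bigr => j _; rewrite ltn_eqF.
Qed.

End Evaluation.

(** * Faces as zero sets of functionals *)

Section EvaluationKernel.
Context {R : realType} {d : nat}.
Implicit Types (h : 'cV[R]_d) (y : 'rV[R]_d).

Definition ker_ev h : {vspace 'rV[R]_d} :=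
  lker (linfun (mulmxr h : 'rV[R]_d -> 'rV[R]_1)).

Lemma mem_ker_ev h y : (y \in ker_ev h) = (ev h y == 0).
Proof.
rewrite memv_ker lfunE /= /ev; apply/eqP/eqP => [->|yh]; first by rewrite mxE.
by apply/rowP => j; rewrite ord1 yh mxE.
Qed.

Lemma dim_cap_ker_ev (U : {vspace 'rV[R]_d}) h y : y \in U -> ev h y != 0 ->
  \dim U = (\dim (U :&: ker_ev h)).+1.
Proof.
move=> yU hy; rewrite -(limg_ker_dim (linfun (mulmxr h : 'rV[R]_d -> 'rV[R]_1)) U).
rewrite -[RHS]addn1; congr addn; apply/eqP; rewrite eqn_leq; apply/andP; split.
  by apply: leq_trans (dimvS (subvf _)) _; rewrite dimvf dim_matrix.
rewrite lt0n dimv_eq0; apply: contra hy => /eqP U0.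
by rewrite -mem_ker_ev memv_ker -memv0 -U0 memv_img.
Qed.

End EvaluationKernel.

(* The cone of [Q] is [{y | 0 <= h i y for all i}]; a face is determined by the
   set of functionals [h i] vanishing on it.  Redundant functionals are allowed. *)
Record face_model (R : realType) d (Q : pointedAffineSemigroup d) := FaceModel {
  fm_size : nat;
  fm_cov : 'I_fm_size -> 'cV[R]_d;
  fm_zeros : face Q -> {set 'I_fm_size};
  fm_ge0 : forall a i, sgset Q a -> 0 <= ev (fm_cov i) (toR a);
  fm_face : forall F a, sgset Q a ->
    face_set F a <-> (forall i, i \in fm_zeros F -> ev (fm_cov i) (toR a) = 0);
  fm_span : forall F y,
    y \in real_span R (face_set F) <-> (forall i, i \in fm_zeros F -> ev (fm_cov i) y = 0);
  fm_relint : forall F, exists y,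
    forall i, if i \in fm_zeros F then ev (fm_cov i) y = 0 else 0 < ev (fm_cov i) y;
  fm_min : forall y, (forall i, 0 <= ev (fm_cov i) y) ->
    exists F, fm_zeros F = [set i | ev (fm_cov i) y == 0]%SET;
  fm_sub : forall G F, subface G F = (fm_zeros F \subset fm_zeros G)
}.

(** * The face model attached to a halfspace description *)

Section FaceModel.
Context {R : realType} {d : nat} {Q : pointedAffineSemigroup d}.
Variables (n : nat) (g : nat -> 'rV[int]_d) (m : nat) (h : 'I_m -> 'cV[int]_d).
Hypothesis gQ : forall j, sgset Q (g j).
Hypothesis Qg : forall a, sgset Q a -> cone n g (toR a : 'rV[R]_d).
Hypothesis hP : forall y : 'rV[R]_d,
  cone n g y <-> forall i, 0 <= ev (covR (h i)) y.

Let hR i : 'cV[R]_d := covR (h i).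

Let ge0 a i : sgset Q a -> 0 <= ev (hR i) (toR a).
Proof. by move=> /Qg/hP; apply. Qed.

Let zeros (F : face Q) : {set 'I_m} :=
  [set i | `[< forall a, face_set F a -> ev (hR i) (toR a) = 0 >]]%SET.

Let zerosP F i a : i \in zeros F -> face_set F a -> ev (hR i) (toR a) = 0.
Proof. by rewrite inE => /asboolP; apply. Qed.

Let face_sub (F : face Q) a : face_set F a -> sgset Q a.
Proof. by have [l [_ ->]] := face_setP F; case. Qed.

Let face0 (F : face Q) : face_set F 0.
Proof. by have [l [_ ->]] := face_setP F; split; [exact: sg0 | rewrite raddf0]. Qed.

Let faceD (F : face Q) a b : face_set F a -> face_set F b -> face_set F (a + b).
Proof.
have [l [_ ->]] := face_setP F => -[aQ la] [bQ lb].
by split; [exact: sgD | rewrite raddfD la lb].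
Qed.

(** For each functional not identically zero on [F], take a point of [F] where it is positive; the
    sum of these points works, all functionals being nonnegative on [Q]. *)
Let relint F : exists2 a, face_set F a & forall i, i \notin zeros F -> 0 < ev (hR i) (toR a).
Proof.
have /boolp.choice[b bP] i : exists a, face_set F a /\ (i \notin zeros F -> 0 < ev (hR i) (toR a)).
  have [iF|] := boolP (i \in zeros F); first by exists 0.
  rewrite inE => /asboolPn/existsNP[a /not_implyP[aF nz]]; exists a; split=> // _.
  by have := ge0 i (face_sub aF); rewrite le_eqVlt => /orP[/eqP/esym|].
exists (\sum_i b i).
  by elim/big_ind: _ => // [u v|i _]; [exact: faceD | exact: (bP i).1].
move=> i /(bP i).2 bi; rewrite toR_sum ev_sum (bigD1 i) //= ltr_wpDr //.
by apply: sumr_ge0 => j _; apply/ge0/face_sub/(bP j).1.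
Qed.

(* Adding a large multiple of a relative interior point of [F] makes all the
   functionals that do not vanish on [F] nonnegative. *)
Let deep F y : (forall i, i \in zeros F -> 0 <= ev (hR i) y) ->
  exists2 a, face_set F a & exists2 N, 0 <= N & cone n g (y + N *: toR a).
Proof.
move=> yF; have [a aF apos] := relint F; exists a => //.
have [N [N0 Nmax _]] := seq_max_ge0 [seq i <- enum 'I_m | i \notin zeros F]
  (fun i => - ev (hR i) y / ev (hR i) (toR a)).
exists N => //; apply/hP => i; rewrite evD evZ -/(hR i).
have [iF|iF] := boolP (i \in zeros F).
  by rewrite (zerosP iF aF) mulr0 addr0 yF.
have := Nmax i; rewrite mem_filter iF mem_enum => /(_ isT).
by rewrite -lerBlDl sub0r ler_pdivrMr ?apos.
Qed.

(** If the functionals in [zeros F] vanish at [a], then [- a] plus a multiple of some [b] in [F]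
    lies in the cone. The functional [l] defining [F] is nonnegative there and zero at [b], hence
    nonpositive at [a]. *)
Let faceE F a : sgset Q a ->
  face_set F a <-> (forall i, i \in zeros F -> ev (hR i) (toR a) = 0).
Proof.
move=> aQ; split=> [aF i iF|az]; first exact: zerosP iF aF.
have [|b bF [N N0 [c c0 cE]]] := @deep F (- toR a).
  by move=> i iF; rewrite evN az // oppr0.
have [l [l0 FE]] := face_setP F; rewrite FE; split=> //.
have lb : l b = 0 by move: bF; rewrite FE; case.
have lR u : ev (covR (cov_of l)) (toR u) = (l u)%:~R :> R by rewrite ev_toR cov_ofE.
have := congr1 (ev (covR (cov_of l))) cE.
rewrite evD evN evZ !lR lb mulr0 addr0 ev_sum => lE.
apply/eqP; rewrite eq_le l0 // andbT -(lerz0 R) -oppr_ge0 lE.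
apply: sumr_ge0 => j _; rewrite evZ lR mulr_ge0 // ler0z l0 //; exact: gQ.
Qed.

Let cone_face F c y : (forall j, 0 <= c j) -> y = \sum_(j < n) c j *: toR (g j) ->
  (forall i, i \in zeros F -> ev (hR i) y = 0) ->
  forall j : 'I_n, c j != 0 -> face_set F (g j).
Proof.
move=> c0 yE yF j cj; apply/faceE; first exact: gQ.
move=> i /yF; rewrite yE ev_sum => /eqP; rewrite psumr_eq0; last first.
  by move=> r _; rewrite evZ mulr_ge0 // ge0.
move=> /allP/(_ j (mem_index_enum _)) /=.
by rewrite evZ mulf_eq0 (negPf cj) => /eqP.
Qed.

Let spanE F y :
  y \in real_span R (face_set F) <-> (forall i, i \in zeros F -> ev (hR i) y = 0).
Proof.
have [SF Smin] := real_spanP R (face_set F); split=> [yS i iF|yF].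
  apply/eqP; rewrite -mem_ker_ev.
  suff /subvP : (real_span R (face_set F) <= ker_ev (hR i))%VS by apply.
  by apply: Smin => a aF; rewrite mem_ker_ev (zerosP iF aF).
(* [y] is the difference of [y + N *: toR a], a combination of generators lying in [F], and of a
   multiple of a point of [F]. *)
have [|a aF [N N0 [c c0 cE]]] := @deep F y; first by move=> i /yF ->.
have aS : toR a \in real_span R (face_set F) by apply: SF.
rewrite -[y](addrK (N *: toR a)) rpredB ?rpredZ // cE rpred_sum // => j _.
have [->|cj] := eqVneq (c j) 0; first by rewrite scale0r rpred0.
apply/rpredZ/SF/(cone_face c0 cE) => // i iF.
by rewrite evD evZ (zerosP iF aF) mulr0 addr0 yF.
Qed.

Let minE y : (forall i, 0 <= ev (hR i) y) ->
  exists F, zeros F = [set i | ev (hR i) y == 0]%SET.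
Proof.
move=> /hP[c c0 yE]; pose J := [set i | ev (hR i) y == 0]%SET.
(* On [Q] this sum of nonnegative terms vanishes only where every term does. The [h i] being
   integral, [l] takes integer values, as [is_face] requires. *)
pose l := cov_fun (\sum_(i in J) h i).
have lE a : l a = \sum_(i in J) cov_fun (h i) a.
  by rewrite /l /cov_fun mulmx_sumr summxE.
have h0 a i : sgset Q a -> 0 <= cov_fun (h i) a.
  by move=> /(ge0 i); rewrite ev_toR ler0z.
have /is_faceP[F FE] : is_face Q [set a | sgset Q a /\ l a = 0].
  exists l; split=> // a aQ; rewrite [X in 0 <= X]lE; apply: sumr_ge0 => i _; exact: h0.
have Fh a : face_set F a <-> sgset Q a /\ forall i, i \in J -> ev (hR i) (toR a) = 0.
  rewrite FE; split=> -[aQ] => [la0|az].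
    have := lE a; rewrite [LHS]la0 => /esym/eqP.
    rewrite psumr_eq0 => [/allP l0|i _]; last exact: h0.
    split=> // i iJ; have := l0 i (mem_index_enum _).
    by rewrite iJ /= => /eqP ai; rewrite ev_toR -/(cov_fun _ _) ai.
  split=> //; rewrite [LHS]lE; apply: big1 => i /az/eqP.
  by rewrite ev_toR intr_eq0 => /eqP.
exists F; apply/setP => i; rewrite [RHS]inE; apply/idP/idP => [iF|/eqP iy].
  rewrite yE ev_sum big1 // => j _; rewrite evZ.
  have [->|cj] := eqVneq (c j) 0; first by rewrite mul0r.
  rewrite (zerosP iF) ?mulr0 //; apply/Fh; split; first exact: gQ.
  move=> r; rewrite inE yE ev_sum psumr_eq0 => [/allP/(_ j (mem_index_enum _)) /=|q _].
    by rewrite evZ mulf_eq0 (negPf cj) => /eqP.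
  by rewrite evZ mulr_ge0 // ge0.
by rewrite inE; apply/asboolP => a /Fh[_]; apply; rewrite inE iy.
Qed.

Let subE G F : subface G F = (zeros F \subset zeros G).
Proof.
apply/asboolP/fintype.subsetP => [GF i iF|FG a aG].
  by rewrite inE; apply/asboolP => a /GF; apply: zerosP.
by apply/(faceE F (face_sub aG)) => i /FG iG; apply: zerosP aG.
Qed.

Definition face_model_of_halfspaces : face_model R Q.
Proof.
refine (@FaceModel R d Q m hR zeros ge0 faceE spanE _ minE subE).
move=> F; have [a aF apos] := relint F; exists (toR a) => i.
by case: ifPn => [iF|/apos//]; apply: zerosP aF.
Defined.

End FaceModel.

Lemma face_model_exists (R : realType) d (Q : pointedAffineSemigroup d) :
  inhabited (face_model R Q).
Proof.
have [n [g Qg]] := sg_fg Q.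
pose g' j := if insub j is Some i then g i else 0 : 'rV[int]_d.
have gQ j : sgset Q (g' j).
  rewrite /g'; case: insubP => [i _ _|_]; last exact: sg0.
  rewrite Qg; exists (fun r => (r == i) : nat); rewrite (bigD1 i) //= eqxx mulr1n.
  by rewrite big1 ?addr0 // => r /negPf ->; rewrite mulr0n.
have Qcone a : sgset Q a -> cone n g' (toR a : 'rV[R]_d).
  rewrite Qg => -[c ->]; exists (fun j => if insub j is Some i then (c i)%:R else 0).
    by move=> j; case: insub => [i|] //; exact: ler0n.
  by rewrite toR_sum; apply: eq_bigr => i _; rewrite /g' valK toRMn.
have [hs hsP] := @cone_halfspaces R d n g'.
constructor; apply: (@face_model_of_halfspaces R d Q n g' (size hs) (tnth (in_tuple hs))) => //.
move=> y; split=> [/hsP H i|H]; first by apply/H/mem_tnth.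
by apply/hsP => h /(tnthP (in_tuple hs))[i ->].
Qed.

(** * Tangent faces *)

Section GenericPoints.
Context {R : realType} {d : nat}.
Implicit Types (x v : 'rV[R]_d) (L P N s : seq 'cV[R]_d).

Lemma small_perturbation s x v : exists2 e : R, 0 < e & forall h, h \in s ->
  (0 < ev h x -> 0 < ev h (x + e *: v)) /\ (ev h x < 0 -> ev h (x + e *: v) < 0).
Proof.
have [t [t0 tmax _]] := seq_max_ge0 s (fun h => `|ev h v| / `|ev h x|).
(* The summand [1] keeps the inverse defined when [t = 0] and makes the estimate strict. Functionals
   vanishing at [x] contribute the quotient [0] to the maximum, and nothing is claimed about
   them. *)
exists (1 + t)^-1; first by rewrite invr_gt0; lra.
move=> h hs; rewrite evD evZ.
have [->|hx0] := eqVneq (ev h x) 0; first by rewrite ltxx.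
have hv : `|(1 + t)^-1 * ev h v| < `|ev h x|.
  rewrite normrM ger0_norm ?invr_ge0 ?addr_ge0 // mulrC ltr_pdivrMr; last by lra.
  have hx : 0 < `|ev h x| by rewrite normr_gt0.
  have := tmax h hs; rewrite ler_pdivrMr // => /le_lt_trans; apply.
  by rewrite mulrC ltr_pM2l //; lra.
by split=> hx; move: hv; [rewrite (gtr0_norm hx) | rewrite (ltr0_norm hx)];
  rewrite ltr_norml => /andP[]; lra.
Qed.

(** Each functional in [N] is nonzero somewhere on the subspace cut out by [L], so a small move
    inside that subspace makes it nonzero without spoiling the strict inequalities already
    obtained. *)
Lemma generic_point L P N v0 :
  (forall h, h \in L -> ev h v0 = 0) -> (forall h, h \in P -> 0 < ev h v0) ->
  (forall h, h \in N -> exists2 u, forall h', h' \in L -> ev h' u = 0 & ev h u != 0) ->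
  exists v, [/\ forall h, h \in L -> ev h v = 0, forall h, h \in P -> 0 < ev h v &
    forall h, h \in N -> ev h v != 0].
Proof.
move=> L0 P0; elim: N => [|f N IH] Nu; first by exists v0.
have [|v [vL vP vN]] := IH; first by move=> h hN; apply: Nu; rewrite inE hN orbT.
have [fv|fv] := eqVneq (ev f v) 0; last first.
  by exists v; split=> // h /[!inE] /orP[/eqP ->|/vN].
have [|u uL fu] := Nu f; first exact: mem_head.
have [e e0 eP] := small_perturbation (P ++ N) v u.
exists (v + e *: u); split=> [h hL|h hP|h].
- by rewrite evD evZ vL // uL // mulr0 addr0.
- by apply: (eP h _).1; rewrite ?mem_cat ?hP ?vP.
rewrite inE => /orP[/eqP ->|hN].
  by rewrite evD evZ fv add0r mulf_neq0 // gt_eqF.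
have [pos neg] : (0 < ev h v -> 0 < ev h (v + e *: u)) /\ (ev h v < 0 -> ev h (v + e *: u) < 0).
  by apply: eP; rewrite mem_cat hN orbT.
by have := vN h hN; rewrite neq_lt => /orP[/neg/lt_eqF ->|/pos/gt_eqF ->].
Qed.

End GenericPoints.

Lemma subface_anti d (Q : pointedAffineSemigroup d) (G F : face Q) :
  subface G F -> subface F G -> G = F.
Proof. by move=> /asboolP GF /asboolP FG; apply/face_set_inj/seteqP. Qed.

(** * Matchings of tangent faces by wall crossing *)

Section TangentFaces.
Context {R : realType} {d : nat} {Q : pointedAffineSemigroup d}.
Variable M : face_model R Q.
Implicit Types (F G H : face Q) (x y : 'rV[R]_d).
Local Notation Z := (fm_zeros M).
Local Notation h := (@fm_cov R d Q M).

Lemma fm_zeros_inj : injective Z.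
Proof.
by move=> F G ZE; apply: subface_anti; rewrite (fm_sub M) ZE.
Qed.

(* The faces [G] of [F] such that [x] lies in the cone [F - G]. *)
Definition tangent_faces x F : {set face Q} :=
  [set G | subface G F && [forall i in Z G, 0 <= ev (h i) x]]%SET.

Lemma tangent_facesP x F G : reflect
  (Z F \subset Z G /\ forall i, i \in Z G -> 0 <= ev (h i) x) (G \in tangent_faces x F).
Proof.
by rewrite inE (fm_sub M); apply: (iffP andP) => -[-> /forall_inP].
Qed.

(* Move from [x] along a generic line until it first hits a hyperplane
   [h i = 0], at [y], and then slightly further, to [x']. *)
Lemma first_wall F x :
  (forall i, i \in Z F -> ev (h i) x = 0) ->
  (exists2 i, i \notin Z F & 0 <= ev (h i) x) ->
  exists y x' i0, [/\
    forall i, i \in Z F -> ev (h i) y = 0 /\ ev (h i) x' = 0,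
    forall i, i \notin Z F -> (0 <= ev (h i) x) = (0 <= ev (h i) y),
    forall i, i \notin Z F -> (0 <= ev (h i) x') = (0 < ev (h i) y),
    i0 \notin Z F /\ ev (h i0) y = 0 &
    forall i u, i \notin Z F -> ev (h i) y = 0 -> (forall j, j \in Z F -> ev (h j) u = 0) ->
      (ev (h i) u == 0) = (ev (h i0) u == 0)].
Proof.
move=> xF [k0 k0F xk0].
have hs i : h i \in [seq h i | i <- enum 'I_(fm_size M)] by rewrite map_f // mem_enum.
have [v0 v0F] := fm_relint M F.
have v0Z i : i \in Z F -> ev (h i) v0 = 0 by move=> iF; have := v0F i; rewrite iF.
have v0P i : i \notin Z F -> 0 < ev (h i) v0 by move=> iF; have := v0F i; rewrite (negPf iF).
(* A small move into the relative interior of [F] takes [x] off all walls: functionals outside [Z F]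
   that were nonnegative become positive, the others stay negative. *)
have [e e0 eP] := small_perturbation [seq h i | i <- enum 'I_(fm_size M)] x v0.
set x1 := x + e *: v0 in eP.
have x1Z i : i \in Z F -> ev (h i) x1 = 0 by move=> iF; rewrite evD evZ xF ?v0Z // mulr0 addr0.
have x1P i : i \notin Z F -> (0 <= ev (h i) x) = (0 < ev (h i) x1).
  move=> iF; have [pos neg] := eP _ (hs i).
  have [/pos ->//|/neg lt0|xi] := ltgtP 0 (ev (h i) x).
    by apply/esym/negbTE; rewrite -leNgt ltW.
  by rewrite evD evZ -xi add0r mulr_gt0 // v0P.
(* [phi i j] vanishes at [v] when the line from [x1] along [- v] meets the walls of [h i] and [h j]
   at the same time. For generic [v] this forces [h i] and [h j] to be proportional on the span of
   [F]. *)
pose phi i j : 'cV[R]_d := ev (h j) x1 *: h i - ev (h i) x1 *: h j.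
have phiE i j u : ev (phi i j) u = ev (h j) x1 * ev (h i) u - ev (h i) x1 * ev (h j) u.
  by rewrite /phi evBl !evZl.
pose LF := [seq h i | i <- enum (Z F)].
pose inF u := forall i, i \in Z F -> ev (h i) u = 0.
have LFP u : inF u -> forall f, f \in LF -> ev f u = 0.
  by move=> uF f /mapP[i]; rewrite mem_enum => iF ->; apply: uF.
pose bad (p : 'I_(fm_size M) * 'I_(fm_size M)) := `[< exists2 u, inF u & ev (phi p.1 p.2) u != 0 >].
have [|||v [vL vP vN]] := @generic_point R d LF [seq h i | i <- enum (~: Z F)%SET]
    [seq phi p.1 p.2 | p <- enum bad] v0.
- exact: LFP.
- by move=> f /mapP[i]; rewrite mem_enum inE => iF ->; apply: v0P.
- move=> f /mapP[p]; rewrite mem_enum => /asboolP[u uF fu] ->; exists u => //; exact: LFP.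
have {}vL : inF v by move=> i iF; apply: vL; rewrite map_f // mem_enum.
have {}vP i : i \notin Z F -> 0 < ev (h i) v.
  by move=> iF; apply: vP; rewrite map_f // mem_enum inE.
have {}vN i j : ev (phi i j) v = 0 -> forall u, inF u -> ev (phi i j) u = 0.
  move=> ij u uF; apply/eqP; apply: contraT => iju.
  have := vN (phi i j); rewrite ij eqxx; apply.
  by rewrite (map_f (fun p => phi p.1 p.2) (x := (i, j))) // mem_enum; apply/asboolP; exists u.
have k0P : (k0 \notin Z F) && (0 < ev (h k0) x1) by rewrite k0F -x1P.
(* [i0] is the first functional, among those positive at [x1], to reach zero along the line. *)
have [i0 /andP[i0F i0x] i0min] := @arg_minP _ _ _ k0
   (fun i => (i \notin Z F) && (0 < ev (h i) x1)) (fun i => ev (h i) x1 / ev (h i) v) k0P.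
pose t := ev (h i0) x1 / ev (h i0) v.
have t0 : 0 < t by rewrite divr_gt0 // vP.
pose y := x1 - t *: v.
have yZ : inF y by move=> i iF; rewrite evB evZ x1Z ?vL // mulr0 subr0.
have yE i : ev (h i) y = ev (h i) x1 - t * ev (h i) v by rewrite evB evZ.
have yP i : i \notin Z F -> (0 < ev (h i) x1) = (0 <= ev (h i) y).
  move=> iF; rewrite yE subr_ge0; have [xi|xi] := ltP 0 (ev (h i) x1).
    by rewrite -ler_pdivlMr ?vP // i0min // iF.
  by apply/esym/negbTE; rewrite -ltNge; apply: le_lt_trans xi _; rewrite mulr_gt0 ?vP.
have [e2 e20 e2P] := small_perturbation [seq h i | i <- enum 'I_(fm_size M)] y (- v).
set x2 := y + e2 *: (- v) in e2P.
exists y, x2, i0; split.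
- by move=> i iF; rewrite yZ // evD evZ evN yZ // vL // oppr0 mulr0 addr0.
- by move=> i iF; rewrite x1P // yP.
- move=> i iF; have [pos neg] := e2P _ (hs i).
  have [/pos/ltW ->//|/neg lt0|yi] := ltgtP 0 (ev (h i) y).
    by apply/negbTE; rewrite -ltNge.
  rewrite evD evZ evN -yi add0r mulrN oppr_ge0; apply/negbTE; rewrite -ltNge.
  by rewrite mulr_gt0 // vP.
- by rewrite yE /t divfK ?subrr // gt_eqF // vP.
move=> i u iF yi uF.
have xiE : ev (h i) x1 = t * ev (h i) v by apply/eqP; rewrite -subr_eq0 -yE yi.
have xi0E : ev (h i0) x1 = t * ev (h i0) v by rewrite /t divfK // gt_eqF // vP.
have /vN/(_ u uF) : ev (phi i i0) v = 0 by rewrite phiE xiE xi0E; ring.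
rewrite phiE xiE xi0E => /eqP; rewrite subr_eq0 => /eqP/(congr1 (fun r => r == 0)).
by rewrite /= !mulf_eq0 invr_eq0 (gt_eqF i0x) !(gt_eqF (vP _ _)).
Qed.

Lemma subface_face_dim G F : subface G F -> (face_dim R G <= face_dim R F)%N.
Proof.
rewrite (fm_sub M) => /fintype.subsetP FG; apply/dimvS/subvP => y /(fm_span M) yG.
by apply/(fm_span M) => i /FG /yG.
Qed.

(** The span of [H] is here the section of the span of [F] by the hyperplane of [h i], of
    codimension one because [h i] is positive in the relative interior of [F]. *)
Lemma facet_cap_ker F H i : i \notin Z F -> subface H F ->
  (forall y, (forall j, j \in Z F -> ev (h j) y = 0) -> ev (h i) y = 0 ->
    forall j, j \in Z H -> ev (h j) y = 0) ->
  i \in Z H -> facet R H F.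
Proof.
move=> iF HF Hker iH; rewrite /facet HF /=; apply/eqP.
have [y yF] := fm_relint M F; rewrite /face_dim (@dim_cap_ker_ev _ _ _ (h i) y); first last.
- by have := yF i; rewrite (negPf iF) => /gt_eqF ->.
- by apply/(fm_span M) => j jF; have := yF j; rewrite jF.
congr (\dim _).+1; apply/eqP; rewrite eqEsubv; apply/andP; split; apply/subvP => z.
  rewrite memv_cap mem_ker_ev => /andP[/(fm_span M) zF /eqP zi].
  by apply/(fm_span M) => j; apply: Hker.
move=> /(fm_span M) zH; rewrite memv_cap mem_ker_ev zH // eqxx andbT.
apply/(fm_span M) => j jF; apply: zH.
by move: HF; rewrite (fm_sub M) => /fintype.subsetP; apply.
Qed.

Lemma proper_subface_face_dim G F : subface G F -> G != F -> (face_dim R G < face_dim R F)%N.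
Proof.
move=> GF nGF.
have [i iG iF] : exists2 i, i \in Z G & i \notin Z F.
  apply/fintype.subsetPn; rewrite -(fm_sub M); apply: contra nGF => FG.
  exact/eqP/subface_anti.
have [y yF] := fm_relint M F; rewrite /face_dim [X in (_ < X)%N](@dim_cap_ker_ev _ _ _ (h i) y); first last.
- by have := yF i; rewrite (negPf iF) => /gt_eqF ->.
- by apply/(fm_span M) => j jF; have := yF j; rewrite jF.
rewrite ltnS; apply/dimvS/subvP => z /(fm_span M) zG.
rewrite memv_cap mem_ker_ev zG // eqxx andbT; apply/(fm_span M) => j jF; apply: zG.
by move: GF; rewrite (fm_sub M) => /fintype.subsetP; apply.
Qed.

(* Crossing the wall through [y] removes from the tangent faces of [F] those of
   the facet [H] of [F] lying on that wall. *)
Theorem matched_tangent_faces F x :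
  (forall i, i \in Z F -> ev (h i) x = 0) ->
  (exists2 i, i \notin Z F & 0 <= ev (h i) x) ->
  matched (fun s t => facet R t s) (tangent_faces x F).
Proof.
(* Outer induction on the dimension of [F], inner induction on the number of functionals outside
   [Z F] that are nonnegative at [x]; crossing a wall lowers this number. *)
have [n] := ubnP (face_dim R F); elim: n F x => // n IHn F x Fn.
have [m] := ubnP #|[set i in ~: Z F | 0 <= ev (h i) x]%SET|.
elim: m x => // m IHm x xm xF xP.
have [y [x' [i0 [yx'F xy x'y [i0F yi0] wall]]]] := first_wall xF xP.
have yF i : i \in Z F -> ev (h i) y = 0 by case/yx'F.
have x'F i : i \in Z F -> ev (h i) x' = 0 by case/yx'F.
pose W := [set i in ~: Z F | ev (h i) y == 0]%SET.
have -> : tangent_faces x F = tangent_faces y F.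
  apply/setP => G; apply/tangent_facesP/tangent_facesP => -[FG xG]; split=> // i iG.
    by have [/yF ->//|iF] := boolP (i \in Z F); rewrite -xy ?xG.
  by have [/xF ->//|iF] := boolP (i \in Z F); rewrite xy ?xG.
have matched_x' : (exists2 i, i \notin Z F & 0 < ev (h i) y) ->
    matched (fun s t => facet R t s) (tangent_faces x' F).
  move=> [i iF yi]; apply: IHm => //; last by exists i; rewrite // x'y.
  rewrite -ltnS; apply: leq_trans xm; rewrite ltnS; apply: proper_card; apply/properP; split.
    apply/fintype.subsetP => j; rewrite !inE => /andP[jF]; rewrite jF x'y // xy //.
    exact: ltW.
  exists i0; rewrite !inE i0F /=; first by rewrite xy // yi0.
  by rewrite x'y // yi0 ltxx.
(* All functionals in [W] define the same wall in the span of [F], so if one of them vanishes on a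
   face of [F], all do. *)
have W_sub (G : face Q) i : Z F \subset Z G -> i \in W -> i \in Z G -> W \subset Z G.
  move=> /fintype.subsetP FG; rewrite !inE => /andP[iF /eqP yi] iG.
  have [p pG] := fm_relint M G.
  have pF j : j \in Z F -> ev (h j) p = 0 by move=> /FG jG; have := pG j; rewrite jG.
  apply/fintype.subsetP => j; rewrite !inE => /andP[jF /eqP yj]; apply: contraT => jG.
  have := wall i p iF yi pF; have := pG i; rewrite iG => ->; rewrite eqxx.
  rewrite -(wall j p jF yj pF); have := pG j.
  by rewrite (negPf jG) => /gt_eqF ->.
(* When no face [H] is cut out by the wall through [y], crossing it leaves the set of tangent faces
   unchanged. *)
have [[H HE]|noH] := EM (exists H, Z H = Z F :|: W); last first.
  have -> : tangent_faces y F = tangent_faces x' F.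
    apply/setP => G; apply/tangent_facesP/tangent_facesP => -[FG yG]; split=> // i iG.
      have [/x'F ->//|iF] := boolP (i \in Z F); rewrite x'y // lt_def yG // andbT.
      apply/negP => yi; apply: noH; have [p pG] := fm_relint M G.
      have iW : i \in W by rewrite !inE iF.
      have /fintype.subsetP WG := W_sub G i FG iW iG.
      (* Far enough in the direction of [p], interior to [G], the translate of [y] lies in the cone
         with exactly the functionals of [Z F] and [W] vanishing, so its minimal face would be
         [H]. *)
      have [N [N0 Nmax _]] := seq_max_ge0 [seq j <- enum 'I_(fm_size M) | j \notin Z G]
        (fun j => - ev (h j) y / ev (h j) p).
      have zE j : if j \in Z F :|: W then ev (h j) (y + (1 + N) *: p) = 0
          else 0 < ev (h j) (y + (1 + N) *: p).
        rewrite evD evZ; have := pG j; have [jG ->|jG pj] := boolP (j \in Z G).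
          rewrite mulr0 addr0 !inE; have [/yF//|jF] := boolP (j \in Z F).
          by rewrite /= lt_def yG // andbT; case: eqP.
        rewrite finset.in_setU (contraNF (fintype.subsetP FG j) jG) (contraNF (WG j) jG) /=.
        have := Nmax j; rewrite mem_filter jG mem_enum => /(_ isT).
        rewrite ler_pdivrMr // mulrDl mul1r; lra.
      have [j|H HE] := fm_min (f := M) (y := y + (1 + N) *: p).
        by have := zE j; case: ifP => _ => [->|/ltW].
      exists H; rewrite HE; apply/setP => j; rewrite [LHS]inE; have := zE j.
      by case: ifP => _ => [->|/gt_eqF ->]; rewrite ?eqxx.
    have [/yF ->//|iF] := boolP (i \in Z F).
    by apply: ltW; rewrite -x'y ?yG.
  (* If nothing outside [Z F] were positive at [y], then [- y] would lie in the cone and its minimal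
     face would be [H]. *)
  apply: matched_x'; apply: contrapT => nP; apply: noH.
  have [j|H HE] := fm_min (f := M) (y := - y).
    rewrite evN oppr_ge0; have [/yF ->//|jF] := boolP (j \in Z F).
    by rewrite leNgt; apply/negP => yj; apply: nP; exists j.
  exists H; rewrite HE; apply/setP => j; rewrite !inE evN oppr_eq0.
  by have [/yF ->|//] := boolP (j \in Z F); rewrite eqxx.
have i0W : i0 \in W by rewrite !inE i0F yi0 eqxx.
have i0H : i0 \in Z H by rewrite HE inE i0W orbT.
have yH i : i \in Z H -> ev (h i) y = 0.
  by rewrite HE !inE => /orP[/yF|/andP[_ /eqP]].
have HF : subface H F by rewrite (fm_sub M) HE finset.subsetUl.
have facetHF : facet R H F.
  apply: (facet_cap_ker i0F) => // z zF zi0 j; rewrite HE !inE => /orP[/zF//|/andP[jF /eqP yj]].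
  by apply/eqP; rewrite (wall j z) // zi0.
have K_H (G : face Q) i : Z F \subset Z G -> i \in W -> i \in Z G -> Z H \subset Z G.
  by move=> FG iW iG; rewrite HE finset.subUset FG (W_sub G i).
have TE : tangent_faces y F = tangent_faces y H :|: tangent_faces x' F.
  apply/setP => G; rewrite [RHS]inE; apply/idP/orP.
    move=> /tangent_facesP[FG yG].
    have [/exists_inP[i iG iW]|/exists_inPn nW] := boolP [exists i in Z G, i \in W].
      by left; apply/tangent_facesP; split=> //; apply: K_H iG.
    right; apply/tangent_facesP; split=> // i iG.
    have [/x'F ->//|iF] := boolP (i \in Z F); rewrite x'y // lt_def yG // andbT.
    by have := nW i iG; rewrite !inE iF.
  move=> [/tangent_facesP[HG yG]|/tangent_facesP[FG x'G]]; apply/tangent_facesP; split=> //.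
    by apply: fintype.subset_trans HG; rewrite -(fm_sub M).
  move=> i iG; have [/yF ->//|iF] := boolP (i \in Z F).
  by apply: ltW; rewrite -x'y ?x'G.
have notx' (G : face Q) : Z H \subset Z G -> G \notin tangent_faces x' F.
  move=> /fintype.subsetP/(_ i0 i0H) i0G; apply/tangent_facesP => -[_ /(_ _ i0G)].
  by rewrite x'y // yi0 ltxx.
(* If some functional outside [Z H] is nonnegative at [y], both parts are matched by induction.
   Otherwise [- y] is interior to [H], and only the pair of [F] and [H] is left. *)
have [/existsP[i /andP[iH yi]]|/existsPn neg] :=
    boolP [exists i, (i \notin Z H) && (0 <= ev (h i) y)].
  have iF : i \notin Z F by apply: contra iH; rewrite HE inE => ->.
  rewrite TE; apply: matchedU.
  - apply: IHn => //; last by exists i.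
    by rewrite -ltnS; apply: leq_trans Fn; case/andP: facetHF => _ /eqP ->.
  - apply: matched_x'; exists i => //; rewrite lt_def yi andbT.
    by apply: contra iH => yi0'; rewrite HE !inE iF yi0' orbT.
  - rewrite disjoint_subset; apply/fintype.subsetP => G /tangent_facesP[HG _].
    by rewrite inE notx'.
  - move=> G G' /tangent_facesP[HG _] G'x'; apply: contraL G'x' => /andP[G'G _].
    by apply: notx'; apply: fintype.subset_trans HG _; rewrite -(fm_sub M).
have ltH i : i \notin Z H -> ev (h i) y < 0 by move=> iH; have := neg i; rewrite iH -ltNge.
suff -> : tangent_faces y F = [set F; H]%SET by apply: matched_pair.
have FT : F \in tangent_faces x' F by apply/tangent_facesP; split=> // i /x'F ->.
have HT : H \in tangent_faces y H by apply/tangent_facesP; split=> // i /yH ->.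
apply/setP => G; rewrite TE [LHS]inE [RHS]inE !finset.in_set1 [RHS]orbC; congr (_ || _).
  apply/idP/eqP => [/tangent_facesP[HG yG]|->//].
  apply/fm_zeros_inj/eqP; rewrite eq_sym finset.eqEsubset HG; apply/fintype.subsetP => i iG.
  by apply: contraT => /ltH; rewrite ltNge yG.
apply/idP/eqP => [/tangent_facesP[FG x'G]|->//].
apply/fm_zeros_inj/eqP; rewrite eq_sym finset.eqEsubset FG; apply/fintype.subsetP => i iG.
apply: contraT => iF; have := x'G i iG; rewrite x'y // => yi.
have /ltH : i \notin Z H by rewrite HE !inE negb_or iF negb_and (gt_eqF yi) orbT.
by rewrite ltNge ltW.
Qed.

(** For [a] interior to [A], the functionals nonnegative at [- a] are those vanishing on [A], so a
    face of [F] is tangent at [- a] exactly when it contains [A]. *)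
Lemma matched_interval A F : subface A F -> A != F ->
  matched (fun s t => facet R t s) [set G : face Q | subface A G && subface G F]%SET.
Proof.
move=> AF nAF; have [a aA] := fm_relint M A.
have az i : (0 <= ev (h i) (- a)) = (i \in Z A).
  rewrite evN oppr_ge0; have := aA i; case: ifP => _ => [->|a0]; first exact: lexx.
  by apply/negbTE; rewrite -ltNge.
suff -> : [set G : face Q | subface A G && subface G F]%SET = tangent_faces (- a) F.
  apply: matched_tangent_faces.
    move=> i iF; have := aA i; move: AF; rewrite (fm_sub M) => /fintype.subsetP/(_ i iF) ->.
    by rewrite evN => ->; rewrite oppr0.
  have /fintype.subsetPn[i iA iF] : ~~ (Z A \subset Z F).
    by rewrite -(fm_sub M); apply: contra nAF => FA; apply/eqP/subface_anti.
  by exists i; rewrite ?az.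
apply/setP => G; rewrite !inE andbC; congr (_ && _); rewrite (fm_sub M).
by apply/fintype.subsetP/forall_inP => H i /H; rewrite az.
Qed.

End TangentFaces.

(** * The total complex in one degree *)

Section FaceLattice.
Context (R : realType) {d : nat} {Q : pointedAffineSemigroup d}.
Implicit Types (A F G : face Q).

Lemma subfacexx F : subface F F. Proof. exact/asboolP. Qed.

Lemma subface_trans G F A : subface A G -> subface G F -> subface A F.
Proof. by move=> /asboolP AG /asboolP GF; apply/asboolP => a /AG/GF. Qed.

Lemma facet_subface G F : facet R G F -> subface G F.
Proof. by case/andP. Qed.

Lemma facet_dim G F : facet R G F -> face_dim R F = (face_dim R G).+1.
Proof. by case/andP => _ /eqP. Qed.

Lemma facet_proper G F : facet R G F -> (face_set G `<` face_set F)%classic.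
Proof.
move=> GF; rewrite properEneq; split; last exact/asboolP/facet_subface.
by apply/eqP => /face_set_inj E; have := facet_dim GF; rewrite E; lia.
Qed.

Lemma facetxx F : facet R F F = false.
Proof. by apply/negP => /facet_dim; lia. Qed.

(** The interval consists of [A], [F] and the faces in [mids]; up to sign its Euler characteristic
    is [2 - #|mids|], which vanishes by the matching. *)
Lemma facets_between A F : subface A F -> face_dim R F = (face_dim R A).+2 ->
  #|[set G | facet R A G && facet R G F]%SET| = 2%N.
Proof.
move=> AF dF; have [M] := face_model_exists R Q.
set mids := [set G | _]%SET.
have nAF : A != F by apply/eqP => E; move: dF; rewrite E; lia.
have AM : A \notin mids by rewrite inE facetxx.
have FM : F \notin mids by rewrite inE facetxx andbF.
have IE : [set G | subface A G && subface G F]%SET = A |: (F |: mids).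
  apply/setP => G; rewrite !inE; apply/andP/or3P => [[AG GF]|].
    have [->|GA] := eqVneq G A; first exact: Or31.
    have [->|GF'] := eqVneq G F; first exact: Or32.
    apply: Or33; rewrite /facet AG GF /=; rewrite eq_sym in GA.
    have := proper_subface_face_dim M AG GA; have := proper_subface_face_dim M GF GF'.
    by move=> *; apply/andP; split; apply/eqP; lia.
  case=> [/eqP ->|/eqP ->|/andP[/facet_subface ? /facet_subface]] //.
    by split=> //; exact: subfacexx.
  by split=> //; exact: subfacexx.
have := matched_sum_sign (fun G' G => @facet_dim G G') (matched_interval M AF nAF).
rewrite IE !big_setU1 //=; last by rewrite finset.in_setU1 negb_or nAF.
rewrite (eq_bigr (fun=> (-1) ^+ (face_dim R A).+1)); last first.
  by move=> G; rewrite inE => /andP[/facet_dim ->].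
rewrite sumr_const dF !exprS !mulN1r opprK mulNrn => E.
have : (-1) ^+ face_dim R A * (2 - #|mids|%:R) = 0 :> int.
  by rewrite mulrBr !mulr_natr mulr2n -addrA.
by move/eqP; rewrite mulf_eq0 signr_eq0 /= subr_eq0 => /eqP; lia.
Qed.

Variable eps : face Q -> face Q -> int.
Hypothesis epsP : incidence_function R eps.

Lemma incidence_sum A F :
  \sum_(G | facet R A G && facet R G F) eps A G * eps G F = 0.
Proof.
have [/existsP[G /andP[AG GF]]|/existsPn no] :=
    boolP [exists G, facet R A G && facet R G F]; last first.
  by rewrite big1 // => G AGF; have := no G; rewrite AGF.
have dF : face_dim R F = (face_dim R A).+2 by rewrite (facet_dim GF) (facet_dim AG).
have AF := subface_trans (facet_subface AG) (facet_subface GF).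
have /eqP/cards2P[G1 [G2 [G12 GE]]] := facets_between AF dF.
have GP G' : facet R A G' && facet R G' F = (G' \in [set G1; G2]%SET) by rewrite -GE inE.
have /andP[AG1 G1F] : facet R A G1 && facet R G1 F by rewrite GP !inE eqxx.
have /andP[AG2 G2F] : facet R A G2 && facet R G2 F by rewrite GP !inE eqxx orbT.
rewrite (eq_bigl _ _ GP) big_setU1 ?inE // big_set1.
by apply: epsP.2 => //; apply: facet_proper.
Qed.

End FaceLattice.

(** * Fibers of the Zeeman complex: square zero and exactness *)

Section ZeemanFibers.
Context (R : realType) (k : fieldType) {d : nat} {Q : pointedAffineSemigroup d}.
Variables (D : {set face Q}) (eps : face Q -> face Q -> int).
Hypothesis Dclosed : closed_subcomplex D.
Hypothesis epsP : incidence_function R eps.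
Implicit Types (s t u : face Q * face Q) (A F G : face Q).

(** Defined on all pairs of faces, nested in [D] or not, so that the square of the differential can
    be computed by unrestricted sums. *)
Definition zeeman_coef s t : int := horiz_coef R eps s t + vert_coef R eps s t.
Local Notation deg s := (zeeman_p R s + zeeman_q R s).

Lemma sign_zeeman_q s : (-1 : int) ^ zeeman_q R s = (-1) ^+ face_dim R s.2.
Proof. by rewrite /zeeman_q -exprnN invr_sign. Qed.

Lemma horiz_coef_neq0 s t : horiz_coef R eps s t != 0 -> t.2 = s.2 /\ facet R s.1 t.1.
Proof. by rewrite /horiz_coef; case: ifP => [/andP[/eqP]|] //; rewrite eqxx. Qed.

Lemma vert_coef_neq0 s t : vert_coef R eps s t != 0 -> t.1 = s.1 /\ facet R t.2 s.2.
Proof. by rewrite /vert_coef; case: ifP => [/andP[/eqP]|] //; rewrite eqxx. Qed.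

Lemma zeeman_coef_neq0 s t : zeeman_coef s t != 0 ->
  t.2 = s.2 /\ facet R s.1 t.1 \/ t.1 = s.1 /\ facet R t.2 s.2.
Proof.
rewrite /zeeman_coef; have [->|/horiz_coef_neq0 H _] := eqVneq (horiz_coef R eps s t) 0.
  by rewrite add0r => /vert_coef_neq0; right.
by left.
Qed.

Lemma zeeman_coef_deg s t : zeeman_coef s t != 0 -> deg t = deg s + 1.
Proof.
by rewrite /zeeman_p /zeeman_q => /zeeman_coef_neq0[] [-> /facet_dim ->]; lia.
Qed.

Lemma zeeman_coef_subface s t : zeeman_coef s t != 0 ->
  subface s.1 t.1 /\ subface t.2 s.2.
Proof.
by move=> /zeeman_coef_neq0[] [-> /facet_subface ?]; split=> //; apply: subfacexx.
Qed.

(* If [A] is the minimal face containing [a], this indexes the degree [a] part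
   of the total complex. *)
Definition zeeman_fiber A : {set face Q * face Q} :=
  [set s | [&& s.1 \in D, s.2 \in D, subface s.2 s.1 & subface A s.2]]%SET.

(** Fibers are convex for the arrows, so restricting the differential to a fiber keeps its square
    zero. *)
Lemma zeeman_fiber_between A s t u : s \in zeeman_fiber A -> u \in zeeman_fiber A ->
  zeeman_coef s t != 0 -> zeeman_coef t u != 0 -> t \in zeeman_fiber A.
Proof.
rewrite !inE => /and4P[s1 s2 s21 As] /and4P[u1 u2 u21 Au].
move=> /zeeman_coef_subface[st ts] /zeeman_coef_subface[tu ut].
rewrite (Dclosed u1 tu) (Dclosed s2 ts) (subface_trans Au ut) andbT /=.
exact: subface_trans (subface_trans ts s21) st.
Qed.

Lemma sum_fst (f : face Q * face Q -> int) G :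
  (forall t, t.2 != G -> f t = 0) -> \sum_t f t = \sum_F f (F, G).
Proof.
move=> f0; rewrite (eq_bigr (fun t => f (t.1, t.2))) => [|[]//].
rewrite -(pair_bigA _ (fun F G' => f (F, G'))) /=; apply: eq_bigr => F _.
by rewrite (bigD1 G) //= big1 ?addr0 // => G' G'G; apply: f0.
Qed.

Lemma sum_snd (f : face Q * face Q -> int) F :
  (forall t, t.1 != F -> f t = 0) -> \sum_t f t = \sum_G f (F, G).
Proof.
move=> f0; rewrite (eq_bigr (fun t => f (t.1, t.2))) => [|[]//].
rewrite -(pair_bigA _ (fun F' G => f (F', G))) /= (bigD1 F) //=.
by rewrite [X in _ + X]big1 ?addr0 // => F' F'F; apply: big1 => G _; apply: f0.
Qed.

Lemma sum_horiz_horiz s u : \sum_t horiz_coef R eps s t * horiz_coef R eps t u = 0.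
Proof.
rewrite (@sum_fst _ s.2) => [|t t2]; last first.
  by rewrite /horiz_coef (negPf t2) mul0r.
have [us|us] := eqVneq u.2 s.2; last first.
  by apply: big1 => F _; rewrite /horiz_coef /= (negPf us) mulr0.
pose q := (-1 : int) ^ zeeman_q R s.
transitivity (q * q * \sum_(F | facet R s.1 F && facet R F u.1) eps s.1 F * eps F u.1).
  rewrite mulr_sumr [RHS]big_mkcond /=.
  rewrite /horiz_coef /= us eqxx /=; apply: eq_bigr => F _.
  case: (facet R s.1 F); rewrite ?mul0r //=.
  by case: (facet R F u.1); rewrite ?mulr0 // [_ ^ zeeman_q R (F, _)]/(_ ^ zeeman_q R s) -/q mulrACA.
by rewrite incidence_sum ?mulr0.
Qed.

Lemma sum_vert_vert s u : \sum_t vert_coef R eps s t * vert_coef R eps t u = 0.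
Proof.
rewrite (@sum_snd _ s.1) => [|t t1]; last first.
  by rewrite /vert_coef (negPf t1) mul0r.
have [us|us] := eqVneq u.1 s.1; last first.
  by apply: big1 => F _; rewrite /vert_coef /= (negPf us) mulr0.
transitivity (\sum_(G | facet R u.2 G && facet R G s.2) eps u.2 G * eps G s.2); last first.
  exact: incidence_sum.
rewrite [RHS]big_mkcond /=.
rewrite /vert_coef /= us eqxx /=; apply: eq_bigr => G _.
case: (facet R G s.2); rewrite ?mul0r ?andbF //= andbT.
by case: (facet R u.2 G); rewrite ?mulr0 // mulrC.
Qed.

(** Only two paths contribute, through [(u.1, s.2)] and through [(s.1, u.2)]. Their signs [(-1)^q]
    are opposite, since a vertical step changes [q] by one. *)
Lemma sum_mixed s u :
  \sum_t (horiz_coef R eps s t * vert_coef R eps t u +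
          vert_coef R eps s t * horiz_coef R eps t u) = 0.
Proof.
rewrite big_split /= (bigD1 (u.1, s.2)) //= [X in _ + X + _]big1 => [|[F G] ne]; last first.
  rewrite /horiz_coef /vert_coef /=; case: (eqVneq G s.2) => [G2|]; last by rewrite mul0r.
  case: (eqVneq u.1 F) => [F1|]; last by rewrite mulr0.
  by move: ne; rewrite G2 F1 eqxx.
rewrite addr0 (bigD1 (s.1, u.2)) //= [X in _ + (_ + X)]big1 => [|[F G] ne]; last first.
  rewrite /horiz_coef /vert_coef /=; case: (eqVneq F s.1) => [F1|]; last by rewrite mul0r.
  case: (eqVneq u.2 G) => [G2|]; last by rewrite mulr0.
  by move: ne; rewrite G2 F1 eqxx.
rewrite addr0 /horiz_coef /vert_coef !sign_zeeman_q /= !eqxx /=.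
case: ifP => f1; last by rewrite mul0r mulr0 addr0.
case: ifP => f2; last by rewrite mul0r mulr0 addr0.
by rewrite (facet_dim f2) exprS mulN1r !mulNr [X in _ + X]mulrC addNr.
Qed.

Definition zeeman_coefk s t : k := (zeeman_coef s t)%:~R.
Local Notation c := zeeman_coefk.

Lemma zeeman_coefk_neq0 s t : c s t != 0 -> zeeman_coef s t != 0.
Proof. by apply: contra_neq; rewrite /zeeman_coefk => ->. Qed.

Lemma zeeman_fiber_complex A : is_complex c (zeeman_fiber A).
Proof.
move=> s u sA uA; rewrite (eq_bigr (fun t => (zeeman_coef s t * zeeman_coef t u)%:~R)); last first.
  by move=> t _; rewrite intrM.
rewrite -(rmorph_sum intr) /=.
suff -> : \sum_(t in zeeman_fiber A) zeeman_coef s t * zeeman_coef t u = 0 by rewrite mulr0z.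
rewrite big_mkcond /= (eq_bigr (fun t => zeeman_coef s t * zeeman_coef t u)); last first.
  move=> t _; case: ifPn => // tA; apply/esym/eqP; apply: contraNT tA.
  by rewrite mulf_eq0 negb_or => /andP[st tu]; apply: zeeman_fiber_between st tu.
rewrite (eq_bigr (fun t => horiz_coef R eps s t * horiz_coef R eps t u +
   vert_coef R eps s t * vert_coef R eps t u + (horiz_coef R eps s t * vert_coef R eps t u +
          vert_coef R eps s t * horiz_coef R eps t u))); last first.
  move=> t _; rewrite /zeeman_coef; move: (horiz_coef _ _ s t) (vert_coef _ _ s t).
  by move: (horiz_coef _ _ t u) (vert_coef _ _ t u) => *; ring.
by rewrite big_split /= sum_mixed addr0 big_split /= sum_horiz_horiz sum_vert_vert addr0.
Qed.

Lemma matched_zeeman_fiber A :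
  matched (fun s t => c s t != 0) (zeeman_fiber A :\ (A, A)).
Proof.
have [M] := face_model_exists R Q.
(* Horizontal arrows raise the dimension of the first face; vertical arrows preserve that face. *)
apply: (@matched_fibers _ _ _ _ fst (face_dim R)) => [s t|F].
  by move=> /zeeman_coefk_neq0/zeeman_coef_neq0[] [E /facet_dim dE]; [right; rewrite dE | left].
pose I := [set G | subface A G && subface G F]%SET.
have [/and3P[FD AF nAF]|nF] := boolP [&& F \in D, subface A F & A != F]; last first.
  suff -> : [set s in zeeman_fiber A :\ (A, A) | s.1 == F]%SET = finset.set0 by apply: matched0.
  apply/setP => -[F' G]; rewrite !inE /=; apply/negP => /andP[/andP[nA /and4P[F'D _ GF' AG]]].
  move=> /eqP FE; move: nF; rewrite -FE F'D (subface_trans AG GF') negbK /= => /eqP AE.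
  by move: nA; rewrite -AE in GF' *; rewrite (subface_anti GF' AG) eqxx.
have -> : [set s in zeeman_fiber A :\ (A, A) | s.1 == F]%SET = pair F @: I.
  apply/setP => -[F' G]; rewrite !inE /=; apply/idP/imsetP.
    by move=> /andP[/andP[nA /and4P[F'D GD GF' AG]] /eqP FE]; exists G; rewrite ?inE ?AG -?FE.
  move=> [G']; rewrite inE => /andP[AG' G'F] [-> ->].
  rewrite FD (Dclosed FD G'F) G'F AG' eqxx xpair_eqE eq_sym (negPf nAF) //=.
apply: (matched_imset (e := fun G G' => facet R G' G)) (matched_interval M AF nAF).
  by move=> G G' [].
move=> G G'; rewrite /zeeman_coefk /zeeman_coef /horiz_coef /vert_coef /= facetxx andbF add0r eqxx /=.
(* Incidence numbers are signs, hence stay nonzero in [k] whatever its characteristic. *)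
case: ifP => [/epsP.1[->|->]|_]; rewrite ?eqxx //; first exact: oner_neq0.
by rewrite rmorphN oppr_eq0 oner_neq0.
Qed.

(** Arrows enlarge the first face and shrink the second, so none in the fiber ends at [(A, A)];
    removing this pair leaves a subcomplex. *)
Lemma zeeman_coef_min A s : s \in zeeman_fiber A -> c s (A, A) = 0.
Proof.
rewrite inE => /and4P[_ _ ss As]; apply: contrapT => /eqP/zeeman_coefk_neq0 nz.
have [sA /= _] := zeeman_coef_subface nz; have [M] := face_model_exists R Q.
have E1 : s.1 = A by apply: (subface_anti) sA (subface_trans As ss).
have E2 : s.2 = A by apply: (subface_anti) As; rewrite -E1.
by case: (zeeman_coef_neq0 nz) => -[_]; rewrite /= ?E1 ?E2 facetxx.
Qed.

Lemma sum_zeeman_fiber A (x : face Q * face Q -> k) t :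
  (forall s, x s != 0 -> s \in zeeman_fiber A) ->
  \sum_(s in zeeman_fiber A) x s * c s t = \sum_s x s * c s t.
Proof.
move=> xA; rewrite big_mkcond; apply: eq_bigr => s _; case: ifPn => // sA.
have /eqP -> : x s == 0 by apply: contraNT sA => /xA.
by rewrite mul0r.
Qed.

(* A homogeneous cycle of degree [i] in a fiber bounds as soon as its coordinate
   at [(A, A)], the only pair left out of the matching, vanishes. *)
Lemma zeeman_fiber_exact A i (x : face Q * face Q -> k) :
  (forall s, x s != 0 -> s \in zeeman_fiber A /\ deg s = i) ->
  (forall t, t \in zeeman_fiber A -> \sum_s x s * c s t = 0) ->
  x (A, A) = 0 ->
  exists y : face Q * face Q -> k,
    (forall s, y s != 0 -> s \in zeeman_fiber A /\ deg s + 1 = i) /\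
    (forall t, t \in zeeman_fiber A -> x t = \sum_s y s * c s t).
Proof.
move=> xP xc xA; pose S := zeeman_fiber A :\ (A, A).
have xS s : x s != 0 -> s \in S.
  move=> xs; rewrite finset.in_setD1 (xP s xs).1 andbT.
  by apply: contraNneq xs => ->; rewrite xA.
have Scx : is_complex c S.
  have [AA|AA] := boolP ((A, A) \in zeeman_fiber A); last first.
    suff -> : S = zeeman_fiber A by apply: zeeman_fiber_complex.
    apply/setP => s; rewrite finset.in_setD1; case: eqP => // ->.
    by rewrite (negPf AA).
  have E : zeeman_fiber A = S :|: [set (A, A)]%SET by rewrite finset.setUC finset.setD1K.
  apply: (proj1 (is_complexU (S2 := [set (A, A)]%SET) _ _ _)); last first.
  - by rewrite -E; apply: zeeman_fiber_complex.
  - by move=> s t; rewrite !inE => /andP[_ sA] /eqP ->; rewrite zeeman_coef_min // inE.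
  - by rewrite disjoint_sym disjoints1 finset.setD11.
have anti s t : c s t != 0 -> c t s = 0.
  move=> st; apply: contrapT => /eqP ts.
  have := zeeman_coef_deg (zeeman_coefk_neq0 st).
  by have := zeeman_coef_deg (zeeman_coefk_neq0 ts); lia.
have sumS (z : face Q * face Q -> k) t : (forall s, z s != 0 -> s \in S) ->
    \sum_(s in S) z s * c s t = \sum_s z s * c s t.
  move=> zS; rewrite big_mkcond; apply: eq_bigr => s _; case: ifPn => // sA.
  have /eqP -> : z s == 0 by apply: contraNT sA => /zS.
  by rewrite mul0r.
have [|y yP] := matched_acyclic anti (matched_zeeman_fiber A) Scx (x := x).
  by move=> t; rewrite inE => /andP[_ tA]; rewrite sumS // xc.
(* Acyclicity yields a chain of mixed degrees. The differential being homogeneous, its part of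
   degree [i - 1] already bounds [x]. *)
pose y' s := if (s \in S) && (deg s + 1 == i) then y s else 0.
have y'S s : y' s != 0 -> s \in S /\ deg s + 1 = i.
  by rewrite /y'; case: ifP => [/andP[? /eqP]|_] //; rewrite eqxx.
exists y'; split=> [s /y'S[]|t tA]; first by rewrite inE => /andP[].
rewrite -sumS => [|s /y'S[]//].
have [tS|] := boolP (t \in S); last first.
  rewrite inE tA andbT negbK inE => /eqP ->; rewrite xA big1 // => s.
  by rewrite inE => /andP[_ sA]; rewrite zeeman_coef_min ?mulr0.
have [ti|ti] := eqVneq (deg t) i.
  rewrite yP //; apply: eq_bigr => s sS; rewrite /y' sS /=.
  have [->|st] := eqVneq (c s t) 0; first by rewrite !mulr0.
  by rewrite -(zeeman_coef_deg (zeeman_coefk_neq0 st)) ti eqxx.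
have -> : x t = 0 by apply: contrapT => /eqP/xP[_ E]; rewrite E eqxx in ti.
rewrite big1 // => s sS; have [->|st] := eqVneq (c s t) 0; first by rewrite mulr0.
rewrite /y' sS /= -(zeeman_coef_deg (zeeman_coefk_neq0 st)) (negPf ti) mul0r //.
Qed.

(* The sign of [F (x) e_F] in the image of [1]; see [diagonal_sign_cycle]. *)
Fixpoint diagonal_sign (n : nat) : int :=
  if n is m.+1 then (-1) ^+ n * diagonal_sign m else 1.

Lemma diagonal_sign_neq0 n : (diagonal_sign n)%:~R != 0 :> k.
Proof.
elim: n => [|n IH]; first exact: oner_neq0.
by rewrite [diagonal_sign _]/(_ * _) intrM mulf_neq0 // rmorphXn rmorphN1 /= signr_eq0.
Qed.

(** A coefficient can survive only if [G] is a facet of [F]. It then gets a vertical term from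
    [(F, F)] and a horizontal one from [(G, G)]; their cancellation is the recursion of
    [diagonal_sign]. Values of [x] are prescribed only between [t.2] and [t.1], so that [x] may be
    cut off outside a fiber. *)
Lemma diagonal_sign_cycle t (x : face Q * face Q -> int) : subface t.2 t.1 ->
  (forall F, subface t.2 F -> subface F t.1 -> x (F, F) = diagonal_sign (face_dim R F)) ->
  (forall s, s.1 != s.2 -> x s = 0) ->
  \sum_s x s * zeeman_coef s t = 0.
Proof.
case: t => F G /= GF xd x0.
have [GF'|GF'] := boolP (facet R G F); last first.
  apply: big1 => -[F' G'] _; have [E|/(x0 (F', G')) ->] := eqVneq F' G'; last by rewrite mul0r.
  apply/eqP; rewrite mulf_eq0; apply/orP; right; apply: contraNT GF' => /zeeman_coef_neq0 /=.
  by rewrite E => -[] [-> ].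
have FG : F != G by apply: contraTneq GF' => ->; rewrite facetxx.
rewrite (bigD1 (F, F)) //= (bigD1 (G, G)) /=; last by rewrite xpair_eqE eq_sym (negPf FG).
rewrite big1 ?addr0 => [|[F' G'] /andP[nF nG]]; last first.
  have [E|/(x0 (F', G')) ->] := eqVneq F' G'; last by rewrite mul0r.
  rewrite E in nF nG *; apply/eqP; rewrite mulf_eq0; apply/orP; right.
  by apply: contraT => /zeeman_coef_neq0 /= [] [E' _]; move: nF nG; rewrite E' eqxx.
rewrite !xd ?subfacexx // /zeeman_coef /horiz_coef /vert_coef !sign_zeeman_q /= !eqxx GF' /=.
rewrite (eq_sym G F) (negPf FG) /= !addr0 add0r (facet_dim GF') /= exprS.
by rewrite mulN1r !mulNr [X in _ + X]mulrCA [X in _ + X]mulrA addNr.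
Qed.

End ZeemanFibers.

(** * Coefficients and irreducible ideals *)

Lemma min_face (R : realType) d (Q : pointedAffineSemigroup d) a : sgset Q a ->
  exists A : face Q, forall F, face_set F a <-> subface A F.
Proof.
move=> aQ; have [M] := face_model_exists R Q.
have [i|A AE] := fm_min (f := M) (y := toR a); first exact: fm_ge0.
exists A => F; rewrite (fm_sub M); split=> [/(fm_face M F aQ) aF|/fintype.subsetP FA].
  by apply/fintype.subsetP => i /aF ai; rewrite AE inE ai.
by apply/(fm_face M F aQ) => i /FA; rewrite AE inE => /eqP.
Qed.

Section Coefficients.
Context {k : fieldType} {d : nat} {Q : pointedAffineSemigroup d}.
Implicit Types (D : {set face Q}) (q : sgelt Q) (f : {sgring k[Q]}).

Definition on_faces D q : bool := `[< exists2 F, F \in D & face_set F (sgexp q) >].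

Lemma on_face1 F q : on_faces [set F]%SET q = `[< face_set F (sgexp q) >].
Proof.
apply/asboolP/asboolP => [[F' /finset.set1P ->]//|qF].
by exists F; rewrite ?finset.set11.
Qed.

Lemma off_facesP D f : f \in off_faces D <-> forall q, on_faces D q -> f@_q = 0.
Proof.
split=> [/asboolP fD q /asboolP[F FD qF]|fD].
  by apply: mcoeff_outdom; apply/negP => /fD/(_ F FD).
apply/asboolP => q qf F FD qF; move: qf; rewrite -mcoeff_neq0 fD ?eqxx //.
by apply/asboolP; exists F.
Qed.

(** The representative is arbitrary, but its coefficients at exponents on faces of [D] are not:
    these monomials form a basis of the quotient. *)
Definition qcoef D q (u : quotmod (complex_ideal k D)) : k :=
  if on_faces D q then (qrepr u : {sgring k[Q]})@_q else 0.

Lemma qcoefE D q f : qcoef q (qproj (complex_ideal k D) f) = if on_faces D q then f@_q else 0.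
Proof.
rewrite /qcoef; case: ifP => // qD; apply/eqP; rewrite -subr_eq0 -mcoeffB; apply/eqP.
have : qproj (complex_ideal k D) (qrepr (qproj (complex_ideal k D) f)) = qproj (complex_ideal k D) f.
  exact: qproj_repr.
by move=> /qproj_eq/off_facesP; apply.
Qed.

Fact qcoef_is_zmod_morphism D q : zmod_morphism (@qcoef D q).
Proof.
move=> u v; rewrite -[u]qproj_repr -[v]qproj_repr -raddfB !qcoefE.
by case: ifP; rewrite ?subr0 // mcoeffB.
Qed.
HB.instance Definition _ D q := GRing.isZmodMorphism.Build
  (quotmod (complex_ideal k D)) k (@qcoef D q) (@qcoef_is_zmod_morphism D q).

Lemma qcoef_inj D (u v : quotmod (complex_ideal k D)) :
  (forall q, qcoef q u = qcoef q v) -> u = v.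
Proof.
move=> uv; rewrite -[u]qproj_repr -[v]qproj_repr; apply/qproj_eq/off_facesP => q qD.
by have := uv q; rewrite /qcoef qD mcoeffB => ->; rewrite subrr.
Qed.

Lemma qcoef_off D q (u : quotmod (complex_ideal k D)) : ~~ on_faces D q -> qcoef q u = 0.
Proof. by rewrite /qcoef => /negPf ->. Qed.

Lemma qcoef_supp D q (u : quotmod (complex_ideal k D)) : qcoef q u != 0 ->
  q \in msupp (qrepr u : {sgring k[Q]}).
Proof. by rewrite /qcoef; case: ifP => _; rewrite ?eqxx // mcoeff_neq0. Qed.

Lemma off_faces_subset D D' : (forall q, on_faces D' q -> on_faces D q) ->
  {subset off_faces (k := k) D <= off_faces D'}.
Proof. by move=> D'D f /off_facesP fD; apply/off_facesP => q /D'D; apply: fD. Qed.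

Lemma qcoef_qmap D D' q (u : quotmod (complex_ideal k D)) :
  (forall r, on_faces D' r -> on_faces D r) ->
  qcoef q (qmap (complex_ideal k D') u) = if on_faces D' q then qcoef q u else 0.
Proof.
move=> D'D; rewrite -[u]qproj_repr qmapE; last first.
  by move=> f /off_facesP fD; apply/off_facesP => r /D'D; apply: fD.
by rewrite !qcoefE; case: ifP => // /D'D ->.
Qed.

Lemma mcoeff_sum_mono (B : {fset sgelt Q}) (y : sgelt Q -> k) q :
  (\sum_(r <- B) << y r *g r >> : {sgring k[Q]})@_q = if q \in B then y q else 0.
Proof.
rewrite (raddf_sum (mcoeff q)); transitivity (\sum_(r <- B) y r *+ (r == q)).
  by apply: eq_bigr => r _; apply: mcoeffU.
case: ifPn => [qB|qB].
  rewrite (big_fsetD1 q qB) /= eqxx mulr1n big1_fset ?addr0 // => r.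
  by rewrite in_fsetD1 => /andP[/negPf ->].
rewrite big1_fset // => r rB _; case: eqP => // rq.
by rewrite -rq rB in qB.
Qed.

Definition qcombine D (B : {fset sgelt Q}) (y : sgelt Q -> k) : quotmod (complex_ideal k D) :=
  qproj (complex_ideal k D) (\sum_(q <- B) << y q *g q >> : {sgring k[Q]}).

Lemma qcoef_qcombine D (B : {fset sgelt Q}) (y : sgelt Q -> k) q :
  (y q != 0 -> q \in B /\ on_faces D q) -> qcoef q (qcombine D B y) = y q.
Proof.
move=> yB; rewrite qcoefE mcoeff_sum_mono.
have [y0|/yB[-> ->] //] := eqVneq (y q) 0.
by rewrite y0 !if_same.
Qed.

End Coefficients.

Lemma seq_argmax (R : realType) (T : eqType) (s : seq T) (r : T -> R) : s != [::] ->
  exists2 x, x \in s & forall y, y \in s -> r y <= r x.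
Proof.
elim: s => // x [_ _|z s IH _]; first by exists x => [|y /[!inE] /eqP ->] //; rewrite inE.
have [//|w ws wmax] := IH; have [xw|/ltW wx] := leP (r x) (r w).
  by exists w => [|y /[!inE] /predU1P[->|/wmax]] //; rewrite inE ws orbT.
exists x => [|y]; first exact: mem_head.
by rewrite in_cons => /predU1P[->|/wmax yw] //; apply: le_trans yw wx.
Qed.

(** A general position argument with the roles transposed: differences of distinct exponents act as
    functionals, and the point avoiding their kernels is the functional sought. *)
Lemma separating_functional (R : realType) d (s : seq 'rV[int]_d) :
  exists l : 'rV[int]_d -> R, (forall a b, l (a + b) = l a + l b) /\ {in s &, injective l}.
Proof.
pose phi (p : 'rV[int]_d * 'rV[int]_d) : 'cV[R]_d := (toR p.1 - toR p.2)^T.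
have [||f|v [_ _ vN]] := @generic_point R d [::] [::]
    [seq phi p | p <- allpairs pair s s & p.1 != p.2] 0; rewrite ?in_nil //.
  move=> /mapP[[a b]]; rewrite mem_filter /= => /andP[ab _] ->.
  have /rV0Pn[i ni] : toR a - toR b != 0 :> 'rV[R]_d.
    rewrite subr_eq0; apply: contra ab => /eqP/rowP E; apply/eqP/rowP => i.
    by have := E i; rewrite !mxE => /intr_inj.
  exists (delta_mx 0 i) => //; rewrite /ev -rowE !mxE /=.
  by move: ni; rewrite !mxE.
have ev_sym (a : 'rV[R]_d) : ev a^T v = ev v^T a.
  by rewrite /ev -[in LHS](trmxK v) -trmx_mul mxE.
exists (fun a => ev v^T (toR a)); split=> [a b|a b aS bS ab]; first by rewrite toRD evD.
apply/eqP; apply: contraT => nab; have := vN (phi (a, b)).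
rewrite map_f; last by rewrite mem_filter nab /=; apply/allpairsP; exists (a, b).
by move=> /(_ isT); rewrite /phi ev_sym evB ab subrr eqxx.
Qed.

Lemma sum_single_pair (k : fieldType) (K : choiceType) (B C : {fset K}) (a b : K -> k)
    (e : K -> K -> bool) p r : p \in B -> r \in C -> e p r ->
  (forall x y, x \in B -> y \in C -> e x y -> x = p /\ y = r) ->
  \sum_(x <- B) \sum_(y <- C) (a x * b y) *+ e x y = a p * b r.
Proof.
move=> pB rC epr eP; rewrite (big_fsetD1 p pB) (big_fsetD1 r rC) /= epr mulr1n.
rewrite big1_fset ?addr0 => [|y]; last first.
  rewrite in_fsetD1 => /andP[yr yC] _; case E: (e p y) => //.
  by have [_ yE] := eP p y pB yC E; rewrite yE eqxx in yr.
rewrite big1_fset ?addr0 // => x.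
rewrite in_fsetD1 => /andP[xp xB] _; apply: big1_fset => y yC _; case E: (e x y) => //.
by have [xE _] := eP x y xB yC E; rewrite xE eqxx in xp.
Qed.

(** * Primality and irreducibility of the face ideals *)

Section Irreducible.
Context (R : realType) {k : fieldType} {d : nat} {Q : pointedAffineSemigroup d}.

Lemma face_setD (G : face Q) a b : sgset Q a -> sgset Q b ->
  face_set G (a + b) <-> face_set G a /\ face_set G b.
Proof.
move=> aQ bQ; have [l [l0 ->]] := face_setP G; rewrite /= raddfD; split.
  move=> [_ /eqP]; rewrite paddr_eq0 ?l0 // => /andP[/eqP ? /eqP ?].
  by split; split.
by move=> [[_ ->] [_ ->]]; split; [exact: sgD | rewrite addr0].
Qed.

(* On the monomials of [G], the product of the leading terms for a functional
   separating the exponents involved cannot cancel. *)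
Lemma off_face_prime (G : face Q) (f g : {sgring k[Q]}) :
  f * g \in off_faces [set G]%SET -> f \in off_faces [set G]%SET \/ g \in off_faces [set G]%SET.
Proof.
move=> fgG; apply: contrapT => /not_orP[nf ng].
have supp (e : {sgring k[Q]}) : ~ e \in off_faces [set G]%SET ->
    [seq q <- msupp e | `[< face_set G (sgexp q) >]] != [::].
  move=> ne; apply/negP => /eqP e0; apply/ne/off_facesP => q; rewrite on_face1 => qG.
  apply: mcoeff_outdom; apply/negP => qe.
  by have := mem_filter (fun q => `[< face_set G (sgexp q) >]) q (msupp e);
    rewrite e0 in_nil qG qe.
have [l [lD linj]] := separating_functional R
  ([seq sgexp q | q <- msupp f] ++ [seq sgexp q | q <- msupp g]).
have [p pf pmax] := seq_argmax (fun q => l (sgexp q)) (supp f nf).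
have [r rg rmax] := seq_argmax (fun q => l (sgexp q)) (supp g ng).
move: pf rg; rewrite !mem_filter => /andP[/asboolP pG pf] /andP[/asboolP rG rg].
pose pr := sgmul p r.
have : (f * g)@_pr = 0.
  move/off_facesP: fgG; apply; rewrite on_face1; apply/asboolP.
  by apply/(face_setD G (sgexpP p) (sgexpP r)).
(* Summands of a point of [G] lie in [G], so [l] is bounded on [p'] and [r'] by its maxima at [p]
   and [r]; equality of the sums forces both maxima to be attained, and [l] separates exponents. *)
have key p' r' : p' \in msupp f -> r' \in msupp g -> sgmul p' r' == pr -> p' = p /\ r' = r.
  move=> p'f r'g /eqP prE.
  have E : sgexp p' + sgexp r' = sgexp p + sgexp r := congr1 (@sgexp d Q) prE.
  have [p'G r'G] : face_set G (sgexp p') /\ face_set G (sgexp r').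
    apply/(face_setD G (sgexpP p') (sgexpP r')); rewrite E.
    by apply/(face_setD G (sgexpP p) (sgexpP r)).
  have lp : l (sgexp p') <= l (sgexp p).
    by apply: pmax; rewrite mem_filter p'f andbT; apply/asboolP.
  have lr : l (sgexp r') <= l (sgexp r).
    by apply: rmax; rewrite mem_filter r'g andbT; apply/asboolP.
  have lE : l (sgexp p') + l (sgexp r') = l (sgexp p) + l (sgexp r) by rewrite -!lD E.
  have [l1 l2] : l (sgexp p') = l (sgexp p) /\ l (sgexp r') = l (sgexp r) by split; lra.
  split; apply: sgexp_inj; apply: linj => //; rewrite mem_cat; apply/orP.
  - by left; apply: map_f.
  - by left; apply: map_f.
  - by right; apply: map_f.
  - by right; apply: map_f.
have -> : (f * g)@_pr = f@_p * g@_r.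
  rewrite mcoeffMl.
  exact: (sum_single_pair (fun q => f@_q) (fun q => g@_q)
    (e := fun x y => sgmul x y == pr) pf rg (eqxx _) key).
by move=> /eqP; rewrite mulf_eq0 => /orP[] /eqP; apply/eqP; rewrite mcoeff_neq0.
Qed.

Lemma face_ideal_irreducible (G : face Q) : irreducible_ideal (complex_ideal k [set G]%SET).
Proof.
move=> [I [J [[_ nI] [_ nJ] WE]]].
have [f fI fW] : exists2 f, f \in I & ~ f \in complex_ideal k [set G]%SET.
  by apply: contrapT => no; apply: nI => f fI; apply: contrapT => fW; apply: no; exists f.
have [g gJ gW] : exists2 f, f \in J & ~ f \in complex_ideal k [set G]%SET.
  by apply: contrapT => no; apply: nJ => g gJ; apply: contrapT => gW; apply: no; exists g.
have : (f : {sgring k[Q]}) * g \in complex_ideal k [set G]%SET.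
  rewrite WE; apply/andP; split; last exact: (rpredZ (f : {sgring k[Q]}) gJ).
  by rewrite mulrC; exact: (rpredZ (g : {sgring k[Q]}) fI).
by case/off_face_prime.
Qed.

End Irreducible.

(** * The augmented total complex *)

Section ZeemanCoefficients.
Context (R : realType) (k : fieldType) {d : nat} {Q : pointedAffineSemigroup d}.
Variables (D : {set face Q}) (eps : face Q -> face Q -> int).
Hypothesis Dclosed : closed_subcomplex D.
Hypothesis epsP : incidence_function R eps.
Implicit Types (i : int) (q : sgelt Q) (s t : face Q * face Q) (F G A : face Q).
Local Notation deg s := (zeeman_p R s + zeeman_q R s).
Local Notation c := (zeeman_coefk R k eps).
Local Notation fiber := (zeeman_fiber D).
Local Notation tot i := (zeeman_tot R k D i).

(* The coefficient of [x^q] in the summand of [x] indexed by [s]; it is [0] when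
   there is no such summand. *)
Definition zcoef i (x : tot i) q s : k :=
  if insub s is Some s' then qcoef q (x s' : quotmod (complex_ideal k [set (val s').2]%SET))
  else 0.

Lemma zcoef_val i (x : tot i) q (s : zeeman_pair R D i) :
  zcoef x q (val s) = qcoef q (x s : quotmod (complex_ideal k [set (val s).2]%SET)).
Proof. by rewrite /zcoef valK. Qed.

Lemma zcoef_neq0 i (x : tot i) q s : zcoef x q s != 0 ->
  zeeman_index R D i s /\ face_set s.2 (sgexp q).
Proof.
rewrite /zcoef; case: insubP => [s' si <-|_]; last by rewrite eqxx.
move=> xs; split; first exact: (valP s'); apply: contrapT => qs.
have no : ~~ on_faces [set (val s').2]%SET q by rewrite on_face1; apply/asboolPn.
by move: xs; rewrite (qcoef_off _ no) eqxx.
Qed.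

Lemma zcoef_inj i (x y : tot i) : (forall q s, zcoef x q s = zcoef y q s) -> x = y.
Proof.
move=> xy; apply/ffunP => s; apply: (@qcoef_inj k d Q [set (val s).2]%SET) => q.
by rewrite -!zcoef_val.
Qed.

Lemma zcoef0 i q s : zcoef (0 : tot i) q s = 0.
Proof. by rewrite /zcoef; case: insub => // s'; rewrite dsum0E raddf0. Qed.

Lemma zcoef_supp i (x : tot i) : exists B : {fset sgelt Q},
  forall q s, zcoef x q s != 0 -> q \in B.
Proof.
exists (\bigcup_(s <- enum (zeeman_pair R D i))
  msupp (qrepr (x s : quotmod (complex_ideal k [set (val s).2]%SET)) : {sgring k[Q]}))%fset.
move=> q s; rewrite /zcoef; case: insubP => [s' _ _|_]; last by rewrite eqxx.
by move=> /qcoef_supp qs; apply/bigfcupP; exists s' => //; rewrite mem_enum.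
Qed.

Lemma zcoef_surj i (B : {fset sgelt Q}) (y : sgelt Q -> face Q * face Q -> k) :
  (forall q s, y q s != 0 -> [/\ q \in B, zeeman_index R D i s & face_set s.2 (sgexp q)]) ->
  exists x : tot i, forall q s, zcoef x q s = y q s.
Proof.
move=> yP; exists [ffun s : zeeman_pair R D i =>
  qcombine [set (val s).2]%SET B (fun q => y q (val s)) : face_ring k (val s).2] => q s.
rewrite /zcoef; case: insubP => [s' si <-|si]; last first.
  by apply/esym/eqP; apply: contraNT si => /yP[].
rewrite ffunE qcoef_qcombine // => /yP[qB _ qs]; split=> //.
by rewrite on_face1; apply/asboolP.
Qed.

(** In each exponent [q] the differential is the matrix [c]; this reduces exactness to linear
    algebra in one fiber at a time. *)
Lemma zcoef_diff i (x : tot i) q t :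
  zcoef (gs_diff (tot_zeeman R k D eps) i x : tot (i + 1)) q t =
  if zeeman_index R D (i + 1) t && `[< face_set t.2 (sgexp q) >]
  then \sum_s zcoef x q s * c s t else 0.
Proof.
have [/andP[ti /asboolP qt]|] := ifPn; last first.
  move=> no; apply/eqP; apply: contraNT no => /zcoef_neq0[-> qt] /=.
  exact/asboolP.
have tE : t = val (Sub t ti : zeeman_pair R D (i + 1)) by rewrite SubK.
rewrite {1}tE zcoef_val [X in qcoef q X]ffunE.
rewrite (raddf_sum (@qcoef k d Q [set t.2]%SET q)).
rewrite (bigID (zeeman_index R D i)) /= [X in _ = _ + X]big1 ?addr0; last first.
  move=> s si; have /eqP -> : zcoef x q s == 0; last by rewrite mul0r.
  by apply: contraNT si => /zcoef_neq0[].
rewrite (big_sub (zeeman_index R D i)); apply: eq_bigr => s _.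
rewrite (raddfMz (@qcoef k d Q [set t.2]%SET q)) zcoef_val /zeeman_coefk mulrzr -/(zeeman_coef _ _ _ _).
have [->|st] := eqVneq (zeeman_coef R eps (val s) t) 0; first by rewrite !mulr0z.
congr (_ *~ _); have [_ ts] := zeeman_coef_subface st.
apply: etrans (@qcoef_qmap k d Q [set (val s).2]%SET [set t.2]%SET q (x s) _) _.
  by move=> r; rewrite !on_face1 => /asboolP rt; apply/asboolP; move/asboolP: ts; apply.
by rewrite on_face1; case: asboolP.
Qed.

Lemma zeeman_index_fiber i q A t : (forall F, face_set F (sgexp q) <-> subface A F) ->
  zeeman_index R D i t && `[< face_set t.2 (sgexp q) >] = (t \in fiber A) && (deg t == i).
Proof.
move=> AP; have -> : `[< face_set t.2 (sgexp q) >] = subface A t.2.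
  by apply/asboolP/idP => /AP.
rewrite inE /zeeman_index; case: (_ \in _); case: (_ \in _); case: (subface t.2 t.1) => //=.
exact: andbC.
Qed.

Lemma zcoef_fiber i (x : tot i) q A s : (forall F, face_set F (sgexp q) <-> subface A F) ->
  zcoef x q s != 0 -> s \in fiber A /\ deg s = i.
Proof.
move=> AP /zcoef_neq0[si qs]; have := zeeman_index_fiber i s AP.
by rewrite si (asboolT qs) => /esym/andP[-> /eqP].
Qed.

Lemma zcoef_cycle i (x : tot i) q A t : (forall F, face_set F (sgexp q) <-> subface A F) ->
  gs_diff (tot_zeeman R k D eps) i x = 0 -> t \in fiber A ->
  \sum_s zcoef x q s * c s t = 0.
Proof.
move=> AP dx0 tA; have [ti|ti] := eqVneq (deg t) (i + 1).
  have := zcoef_diff x q t; rewrite (zeeman_index_fiber _ _ AP) tA ti eqxx /= => <-.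
  by rewrite dx0; apply: zcoef0.
apply: big1 => s _; have [->|/(zcoef_fiber AP)[_ si]] := eqVneq (zcoef x q s) 0.
  by rewrite mul0r.
have [->|st] := eqVneq (c s t) 0; first by rewrite mulr0.
by move: ti; rewrite (zeeman_coef_deg (zeeman_coefk_neq0 st)) si eqxx.
Qed.

Lemma zeeman_diff_diff i (x : tot i) :
  gs_diff (tot_zeeman R k D eps) (i + 1) (gs_diff (tot_zeeman R k D eps) i x) = 0.
Proof.
apply: (@zcoef_inj (i + 1 + 1)) => q t; rewrite zcoef0 zcoef_diff.
have [A AP] := min_face R (sgexpP q).
rewrite (zeeman_index_fiber _ _ AP); case: ifP => // /andP[tA _].
transitivity (\sum_(s in fiber A) \sum_(r in fiber A) zcoef x q r * (c r s * c s t)).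
  rewrite [RHS]big_mkcond; apply: eq_bigr => s _.
  rewrite zcoef_diff (zeeman_index_fiber _ _ AP); case: ifPn => [/andP[-> _]|ns].
    rewrite -(@sum_zeeman_fiber R k d Q D eps A) => [|r /(zcoef_fiber AP)[]//].
    by rewrite mulr_suml; apply: eq_bigr => r _; rewrite mulrA.
  rewrite mul0r; case: ifP => // sA; apply/esym/big1 => r rA.
  have [->|/(zcoef_fiber AP)[_ ri]] := eqVneq (zcoef x q r) 0; first by rewrite mul0r.
  have [->|rs] := eqVneq (c r s) 0; first by rewrite mul0r mulr0.
  by move: ns; rewrite sA (zeeman_coef_deg (zeeman_coefk_neq0 rs)) ri eqxx.
rewrite exchange_big big1 // => r rA /=; rewrite -mulr_sumr.
by rewrite (zeeman_fiber_complex k Dclosed epsP rA tA) mulr0.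
Qed.

(** Each exponent is solved by [zeeman_fiber_exact]: the coordinate at [(A, A)] vanishes because
    that pair has degree [0] and [i + 1] is positive. The finite support [B] of [x] lets the
    solutions be assembled. *)
Lemma zeeman_boundary i (x : tot (i + 1)) : 0 <= i ->
  gs_diff (tot_zeeman R k D eps) (i + 1) x = 0 ->
  exists y : tot i, x = gs_diff (tot_zeeman R k D eps) i y.
Proof.
move=> i0 dx0; have [B BP] := zcoef_supp x.
have /boolp.choice[Y YP] q : exists y : face Q * face Q -> k,
    (forall s, y s != 0 -> [/\ q \in B, zeeman_index R D i s & face_set s.2 (sgexp q)]) /\
    (forall t, zeeman_index R D (i + 1) t -> face_set t.2 (sgexp q) ->
      zcoef x q t = \sum_s y s * c s t).
  have [qB|qB] := boolP (q \in B); last first.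
    exists (fun=> 0); split=> [s|t ti qt]; first by rewrite eqxx.
    rewrite big1 => [|s _]; last by rewrite mul0r.
    by apply/eqP; apply: contraNT qB; apply: BP.
  have [A AP] := min_face R (sgexpP q).
  have [||y [y1 y2]] := zeeman_fiber_exact Dclosed epsP (fun s => @zcoef_fiber (i + 1) x q A s AP).
  - by move=> t; apply: zcoef_cycle.
  - apply: contrapT => /eqP/(zcoef_fiber AP)[_].
    by rewrite /zeeman_p /zeeman_q /=; lia.
  exists y; split=> [s /y1[sA si]|t ti qt].
    have : zeeman_index R D i s && `[< face_set s.2 (sgexp q) >].
      by rewrite (zeeman_index_fiber _ _ AP) sA; apply/eqP; lia.
    by move=> /andP[-> /asboolP].
  by apply: y2; have := zeeman_index_fiber (i + 1) t AP; rewrite ti (asboolT qt) => /esym/andP[].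
have [y yE] := zcoef_surj (fun q => (YP q).1).
exists y; apply: (@zcoef_inj (i + 1)) => q t; rewrite zcoef_diff.
case: ifPn => [/andP[ti /asboolP qt]|no].
  by rewrite ((YP q).2 t ti qt); apply: eq_bigr => s _; rewrite yE.
apply/eqP; apply: contraNT no => /zcoef_neq0[-> qt].
exact/asboolP.
Qed.

Lemma zeeman_diag s : zeeman_index R D 0 s -> s.1 = s.2.
Proof.
move=> /and4P[_ _ ss]; rewrite /zeeman_p /zeeman_q => /eqP E.
have [M] := face_model_exists R Q; apply/eqP; apply: contraT => ns.
have := proper_subface_face_dim M ss; rewrite eq_sym => /(_ ns); lia.
Qed.

Local Notation kD := (gquot (complex_ideal k D)).

(** Pairs of degree [0] are diagonal by [zeeman_diag], so the second face alone determines the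
    summand; [1] goes to a signed sum of all [F (x) e_F]. *)
Definition zeeman_eta_fun (m : kD) : tot 0 :=
  [ffun s : zeeman_pair R D 0 =>
     (@qmap _ _ (complex_ideal k D) (complex_ideal k [set (val s).2]%SET) m : face_ring k (val s).2)
       *~ diagonal_sign (face_dim R (val s).2)].

Lemma zeeman_pair_on i (s : zeeman_pair R D i) q :
  on_faces [set (val s).2]%SET q -> on_faces D q.
Proof.
rewrite on_face1 => /asboolP qs; apply/asboolP; exists (val s).2 => //.
by have /and4P[] := valP s.
Qed.

Fact zeeman_eta_linear : linear zeeman_eta_fun.
Proof.
move=> b m n; apply/ffunP => s; rewrite dsumDE dsumZE !ffunE -scalerMzr -mulrzDl; congr (_ *~ _).
exact/qmapZD/off_faces_subset/zeeman_pair_on.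
Qed.
HB.instance Definition _ := GRing.isLinear.Build {sgring k[Q]} kD (tot 0) _
  zeeman_eta_fun zeeman_eta_linear.

Fact zeeman_eta_deg a (m : kD) : gm_comp a m -> gm_comp a (zeeman_eta_fun m).
Proof.
move=> [f [fa ->]] s; rewrite ffunE; apply: gm_compMz; exists f; split=> //.
exact/qmapE/off_faces_subset/zeeman_pair_on.
Qed.

Definition zeeman_eta : gradedHom kD (tot 0) :=
  GradedHom (gh_map := zeeman_eta_fun) zeeman_eta_deg.

Lemma zcoef_eta (m : kD) q s : zcoef (zeeman_eta m) q s =
  if zeeman_index R D 0 s && `[< face_set s.2 (sgexp q) >]
  then qcoef q (m : quotmod (complex_ideal k D)) * (diagonal_sign (face_dim R s.2))%:~R else 0.
Proof.
rewrite /zcoef; case: insubP => [s' si <-|si]; last by rewrite (negPf si).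
rewrite (valP s') /= ffunE (raddfMz (@qcoef k d Q [set (val s').2]%SET q)) -mulrzr.
transitivity ((if on_faces [set (val s').2]%SET q then qcoef q (m : quotmod (complex_ideal k D)) else 0)
    * (diagonal_sign (face_dim R (val s').2))%:~R).
  by congr (_ * _); apply: (@qcoef_qmap k d Q D); apply: zeeman_pair_on.
by rewrite on_face1; case: ifP => // _; rewrite mul0r.
Qed.

Lemma zeeman_eta_inj : injective zeeman_eta.
Proof.
move=> m n mn; apply: (@qcoef_inj k d Q D) => q.
have [/asboolP[F FD qF]|no] := boolP (on_faces D q); last by rewrite !qcoef_off.
have := congr1 (fun x => zcoef (x : tot 0) q (F, F)) mn; rewrite !zcoef_eta.
have -> : zeeman_index R D 0 (F, F).
  by rewrite /zeeman_index FD subfacexx /zeeman_p /zeeman_q /= addrN eqxx.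
by rewrite (asboolT qF) /=; apply/mulIf/diagonal_sign_neq0.
Qed.

Lemma zeeman_diff_eta (m : kD) : gs_diff (tot_zeeman R k D eps) 0 (zeeman_eta m) = 0.
Proof.
apply: (@zcoef_inj (0 + 1)) => q t; rewrite zcoef0 zcoef_diff.
case: ifP => // /andP[/and4P[t1D t2D tt _] /asboolP qt].
pose x s : int := if zeeman_index R D 0 s && `[< face_set s.2 (sgexp q) >]
  then diagonal_sign (face_dim R s.2) else 0.
rewrite (eq_bigr (fun s => qcoef q (m : quotmod (complex_ideal k D)) * (x s * zeeman_coef R eps s t)%:~R)).
  rewrite -mulr_sumr -(rmorph_sum intr) /= (diagonal_sign_cycle eps tt) ?mulr0z ?mulr0 //.
  - move=> F tF Ft; rewrite /x; have -> : zeeman_index R D 0 (F, F).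
      by rewrite /zeeman_index (Dclosed t1D Ft) subfacexx /zeeman_p /zeeman_q /= addrN eqxx.
    by rewrite asboolT //; move/asboolP: tF; apply.
  - move=> s ss; rewrite /x; case: ifP => // /andP[/zeeman_diag E].
    by rewrite E eqxx in ss.
move=> s _; rewrite zcoef_eta intrM mulrA; congr (_ * _).
by rewrite /x; case: ifP => // _; rewrite mulr0.
Qed.

Lemma zeeman_augmentation (x : tot 0) :
  gs_diff (tot_zeeman R k D eps) 0 x = 0 -> exists m, x = zeeman_eta m.
Proof.
move=> dx0; have [B BP] := zcoef_supp x.
have /boolp.choice[l lP] q : exists l : k,
    (l != 0 -> q \in B /\ on_faces D q) /\
    (forall s, zeeman_index R D 0 s -> face_set s.2 (sgexp q) ->
      zcoef x q s = l * (diagonal_sign (face_dim R s.2))%:~R).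
  have [A AP] := min_face R (sgexpP q).
  pose sg F : k := (diagonal_sign (face_dim R F))%:~R.
  (* The coefficient of the preimage at [q] is read off at the minimal pair; it is [0] when [A] is
     not in [D]. *)
  pose l := zcoef x q (A, A) / sg A.
  have lB : l != 0 -> q \in B /\ on_faces D q.
    rewrite mulf_eq0 negb_or => /andP[xA _]; split; first exact: BP xA.
    have [/and4P[/= AD _ _ _] /= qA] := zcoef_neq0 xA.
    by apply/asboolP; exists A.
  exists l; split=> // s si qs.
  (* [z] is the diagonal cycle of the fiber. Subtracting [l] times it kills the coordinate at
     [(A, A)], so the difference bounds. *)
  pose z s : int := if (s \in fiber A) && (s.1 == s.2) then diagonal_sign (face_dim R s.2) else 0.
  have [|||y [y1 y2]] := zeeman_fiber_exact Dclosed epsP (A := A) (i := 0)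
      (x := fun s => zcoef x q s - l * (z s)%:~R).
  - move=> r; have [r0|/(zcoef_fiber AP) //] := eqVneq (zcoef x q r) 0.
    rewrite r0 sub0r oppr_eq0 mulf_eq0 negb_or /z => /andP[_].
    case: ifP => [/andP[rA /eqP rr] _|_]; last by rewrite eqxx.
    by split; rewrite // /zeeman_p /zeeman_q rr addrN.
  - move=> t tA; under eq_bigr => r _ do rewrite mulrBl.
    rewrite sumrB (zcoef_cycle AP) // sub0r; apply/eqP; rewrite oppr_eq0; apply/eqP.
    rewrite (eq_bigr (fun s => l * (z s * zeeman_coef R eps s t)%:~R)); last first.
      by move=> r _; rewrite intrM mulrA.
    have tA' := tA; move: tA'; rewrite inE => /and4P[t1D t2D tt At].
    rewrite -mulr_sumr -(rmorph_sum intr) /= (diagonal_sign_cycle eps tt) ?mulr0z ?mulr0 //.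
    + move=> F tF Ft; rewrite /z inE /= (Dclosed t1D Ft) subfacexx (subface_trans At tF).
      by rewrite eqxx.
    + by move=> r /negPf rr; rewrite /z rr andbF.
  - have [AA|AA] := boolP ((A, A) \in fiber A).
      by rewrite /z AA eqxx /= /l divfK ?subrr // diagonal_sign_neq0.
    have /eqP E : zcoef x q (A, A) == 0 by apply: contraNT AA => /(zcoef_fiber AP)[].
    by rewrite /l E !mul0r subr0.
  have sA : s \in fiber A.
    by have := zeeman_index_fiber 0 s AP; rewrite si (asboolT qs) => /esym/andP[].
  (* The bounding chain [y] has degree [-1], where no nested pair exists; it is zero, and so is the
     difference. *)
  have := y2 s sA; rewrite big1 => [/eqP|r _].
    by rewrite subr_eq0 => /eqP ->; rewrite /z sA (zeeman_diag si) eqxx.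
  have [->|/y1[rA ri]] := eqVneq (y r) 0; first by rewrite mul0r.
  have [M] := face_model_exists R Q.
  move: rA; rewrite inE => /and4P[_ _ rr _]; have := subface_face_dim M rr.
  by move: ri; rewrite /zeeman_p /zeeman_q; lia.
exists (qcombine D B l); apply: zcoef_inj => q s; rewrite zcoef_eta.
case: ifPn => [/andP[si /asboolP qs]|no].
  by rewrite qcoef_qcombine ?((lP q).2 s) //; apply: (lP q).1.
apply/eqP; apply: contraNT no => /zcoef_neq0[-> qs].
exact/asboolP.
Qed.

End ZeemanCoefficients.

(** * Direct sums reindexed by ordinals, as in the definition of an irreducible resolution *)

Section Reindexing.
Context {k : fieldType} {d : nat} {Q : pointedAffineSemigroup d}.
Context {J : finType} (M : J -> gradedModule k Q).
Local Notation src := (gdsum M).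
Local Notation tgt := (gdsum (fun j : 'I_#|J| => M (enum_val j))).

Definition gdsum_reindex_fun (x : src) : tgt :=
  [ffun j : 'I_#|J| => x (enum_val j) : M (enum_val j)].

Fact gdsum_reindex_linear : linear gdsum_reindex_fun.
Proof. by move=> c x y; apply/ffunP => j; rewrite dsumDE dsumZE !ffunE. Qed.
HB.instance Definition _ := GRing.isLinear.Build {sgring k[Q]} src tgt _
  gdsum_reindex_fun gdsum_reindex_linear.

Fact gdsum_reindex_deg a (x : src) : gm_comp a x -> gm_comp a (gdsum_reindex_fun x).
Proof. by move=> xa j; rewrite ffunE. Qed.

Lemma gdsum_reindex : graded_iso src tgt.
Proof.
exists (GradedHom (gh_map := gdsum_reindex_fun) gdsum_reindex_deg).
(* The component at [enum_rank s] lies in [M (enum_val (enum_rank s))] and has to be transported to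
   [M s]. *)
pose g (y : tgt) : src :=
  [ffun s => eq_rect _ (fun s => M s : Type) (y (enum_rank s)) s (enum_rankK s)].
exists g => [x|y]; apply/ffunP => s.
  rewrite /g ffunE /= ffunE; move: (enum_rankK s); move: (enum_rank s) => r e.
  by case: _ / e.
rewrite /= ffunE /g ffunE; move: (enum_rankK (enum_val s)).
move: (enum_rank (enum_val s)) => r e; have rs := enum_val_inj e.
by move: e; rewrite rs => e; rewrite (eq_irrelevance e erefl).
Qed.

End Reindexing.

Theorem proposition3p4 (R : realType) (k : fieldType) (d : nat)
    (Q : pointedAffineSemigroup d)
    (Qnormal : sg_normal Q) (Qgenerates : sg_generates Q)
    (D : {set face Q}) (Dclosed : closed_subcomplex D)
    (eps : face Q -> face Q -> int) (epsP : incidence_function R eps) :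
  irreducible_resolution (gquot (complex_ideal k D)) (tot_zeeman R k D eps).
Proof.
split=> [i i0 x|i i0|].
(* The second face of a nested pair has at most the dimension of the first, so no pair has negative
   degree. *)
- apply: zcoef_inj => q s; rewrite zcoef0; apply/eqP; apply: contraT => /zcoef_neq0[].
  move=> /and4P[_ _ ss /eqP si] _; have [M] := face_model_exists R Q.
  by have := subface_face_dim M ss; move: si; rewrite /zeeman_p /zeeman_q; lia.
- exists #|{: zeeman_pair R D i}|, (fun j => complex_ideal k [set (val (enum_val j)).2]%SET).
  split=> [j|]; first exact: face_ideal_irreducible R _ _ _ _.
  exact: (gdsum_reindex (fun s : zeeman_pair R D i => face_ring k (val s).2)).
- exists (zeeman_eta R k D); split.
  + exact: zeeman_eta_inj.
  + move=> x; split=> [|[m ->]]; first exact: zeeman_augmentation.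
    exact: zeeman_diff_eta.
  + move=> i i0 x; split=> [|[y ->]]; first exact: zeeman_boundary.
    exact: zeeman_diff_diff.
Qed.
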